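(* Let $X$ be a paracompact complex manifold with a locally finite Stein open cover $\mathcal{U}=\{U_\alpha\}$ all of whose finite intersections are Stein, and let $E$ be a holomorphic vector bundle on $X$ trivialised by $\mathcal{U}$, with flat holomorphic connections $\nabla_\alpha$ on $E|_{U_\alpha}$. Let $\omega_{\alpha\beta}=\nabla_\beta-\nabla_\alpha\in\Gamma(U_{\alpha\beta},\mathcal{E}nd(E)\otimes\Omega^1_X)$. Then the element $$\Big(0,\ \tfrac13\operatorname{tr}(\omega_{\alpha\beta}^3),\ \operatorname{tr}(\omega_{\alpha\beta}\,\omega_{\beta\gamma}),\ 0,\ 0\Big)\in \mathrm{Tot}^4\,\check{\mathscr{C}}^\bullet(\Omega_X^\star),$$ whose component of bidegree $(2,2)$ is the trace $\operatorname{tr}\mathrm{at}_E^{\circ 2}$ of the second exponential Atiyah class of $E$, is closed.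
   Context: $\check{\mathscr{C}}^p(\Omega_X^q)=\prod_{(\alpha_0,\dots,\alpha_p)}\Gamma(U_{\alpha_0\cdots\alpha_p},\Omega_X^q)$ is the group of Čech $p$-cochains (not assumed skew-symmetric) for $\mathcal{U}$ with values in holomorphic $q$-forms. $\mathrm{Tot}^r\check{\mathscr{C}}^\bullet(\Omega_X^\star)=\bigoplus_{p+q=r}\check{\mathscr{C}}^p(\Omega_X^q)$, whose elements are written $(c_0,\dots,c_r)$ with $c_p\in\check{\mathscr{C}}^p(\Omega_X^{r-p})$. The total differential is $\check\delta+(-1)^p\mathrm{d}$ on $\check{\mathscr{C}}^p(\Omega_X^q)$, where $\check\delta$ is the Čech differential and $\mathrm{d}$ the de Rham differential. A holomorphic connection is flat if its curvature $\nabla\circ\nabla$ vanishes. The product of endomorphism-valued forms is composition on endomorphisms and wedge product on forms, and all factors are restricted to the relevant intersection. (If $\omega_{\alpha\beta}$ and $\omega_{\beta\gamma}$ are written as matrices in the trivialisations over $U_\alpha$ and $U_\beta$ respectively, then the matrix of $\omega_{\beta\gamma}$ must be conjugated to the $U_\alpha$ trivialisation before multiplying.) The second exponential Atiyah class $\mathrm{at}_E^{\circ2}\in H^2(X,\mathcal{E}nd(E)\otimes\Omega_X^2)$ is represented by the Čech cocycle $(\mathrm{at}_E^{\circ 2})_{\alpha\beta\gamma}=\omega_{\alpha\beta}\,\omega_{\beta\gamma}$. *)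

(* Defs.v *)
From HB Require Import structures.
From mathcomp Require Import all_boot all_order all_algebra all_fingroup.
From mathcomp Require Import complex.
From mathcomp Require Import all_classical all_reals topology normedtype derive.

Import Order.TTheory GRing.Theory Num.Theory.
Import numFieldNormedType.Exports.

Local Open Scope classical_set_scope.
Local Open Scope ring_scope.

(* The complex numbers, packed as a numFieldType: the topology and the norm of
   MathComp-Analysis are inferred for a numFieldType, not for R[i] itself. *)
Definition Cplx (R : realType) : numFieldType := R[i].

(* Over K = Cplx R, [differentiable] is complex Frechet differentiability, so
   for an open D this says that f is holomorphic on D. *)
Definition hol_on {K : numFieldType} {V W : normedModType K}
    (D : set V) (f : V -> W) : Prop :=
  forall z, D z -> differentiable f z.

(* The dimension may depend on the chart: it is locally constant, and X need
   not be connected. As usual, chart_at selects a chart around each point. *)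
Record complex_manifold (R : realType) := {
  mspace :> topologicalType;
  chart : Type;
  cdim : chart -> nat;
  cdom : chart -> set mspace;
  cmap : forall c : chart, mspace -> 'rV[Cplx R]_(cdim c);
  cinv : forall c : chart, 'rV[Cplx R]_(cdim c) -> mspace;
  chart_at : mspace -> chart;
  chart_atP : forall x, cdom (chart_at x) x;
  cdom_open : forall c, open (cdom c);
  cimage_open : forall c, open (cmap c @` cdom c);
  cmapK : forall c x, cdom c x -> cinv c (cmap c x) = x;
  cmap_continuous : forall c x, cdom c x -> {for x, continuous (cmap c)};
  cinv_continuous : forall c z, (cmap c @` cdom c) z ->
    {for z, continuous (cinv c)};
  transition_hol : forall c c', hol_on (cmap c @` (cdom c `&` cdom c'))
    (cmap c' \o cinv c);
  mspace_hausdorff : hausdorff_space mspace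
}.
Arguments chart {R} X : rename.
Arguments cdim {R X} c : rename.
Arguments cdom {R X} c _ : rename.
Arguments cmap {R X} c _ : rename.
Arguments cinv {R X} c _ : rename.
Arguments chart_at {R X} x : rename.

Definition locally_finite {T : topologicalType} {A : Type} (U : A -> set T) :=
  forall x : T, exists2 N, nbhs x N & finite_set [set a | (U a `&` N) !=set0].

Definition open_cover {T : topologicalType} {A : Type} (U : A -> set T) :=
  (forall a, open (U a)) /\ (forall x, exists a, U a x).

(* Hausdorffness is part of complex_manifold. The covers are sets of sets,
   here indexed by themselves. *)
Definition paracompact (T : topologicalType) :=
  forall O : set (set T), open_cover (fun W : {W | O W} => sval W) ->
  exists P : set (set T),
    [/\ open_cover (fun W : {W | P W} => sval W),
        locally_finite (fun W : {W | P W} => sval W) &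
        forall W, P W -> exists2 W', O W' & W `<=` W'].

Definition alternating_multilinear {K : numFieldType} {V : lmodType K} {q n}
    (f : 'M[K]_(q, n) -> V) : Prop :=
  (forall (A B D : 'M[K]_(q, n)) i t,
     row i A = t *: row i B + row i D ->
     row' i B = row' i A -> row' i D = row' i A -> f A = t *: f B + f D) /\
  (forall (A : 'M[K]_(q, n)) i j, i != j -> row i A = row j A -> f A = 0).

Section Forms.
Context {R : realType} {X : complex_manifold R}.
Local Notation C := (Cplx R).

(* T_x X is identified with C^(tdim x) through the chart chart_at x. *)
Definition tdim (x : X) := cdim (chart_at x).

(* q-forms with values in a family of vector spaces V; a q-tuple of tangent
   vectors at x is given by the rows of a q x (tdim x) matrix. *)
Definition vform (q : nat) (V : X -> lmodType C) :=
  forall x : X, 'M[C]_(q, tdim x) -> V x.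

Definition form (q : nat) := vform q (fun _ => C^o).

Definition fun0 (f : X -> C) : form 0 := fun x _ => f x.

(* The coefficient of eta in the chart c on the constant vector fields given by
   the rows of v: the jacobian goes from the coordinates of the chart c to those
   of the chart used for the tangent space at the point cinv c z. *)
Definition coeff {q : nat} (eta : form q) (c : chart X)
    (v : 'M[C]_(q, cdim c)) (z : 'rV[C]_(cdim c)) : C :=
  eta (cinv c z)
    (v *m 'J (cmap (chart_at (cinv c z)) \o cinv c) z).

Definition hol_form {q : nat} (U : set X) (eta : form q) : Prop :=
  (forall x, U x -> alternating_multilinear (eta x)) /\
  (forall c v, hol_on (cmap c @` (U `&` cdom c)) (coeff eta c v)).

Definition hol_fun (U : set X) (f : X -> C) : Prop := hol_form U (fun0 f).

(* d eta (v_0, .., v_q) = \sum_i (-1)^i D_(v_i) eta (v_0, .., ^v_i, .., v_q) in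
   local coordinates around x. *)
Definition dR {q : nat} (eta : form q) : form q.+1 := fun x v =>
  \sum_(i < q.+1) (-1) ^+ i *
    'd (coeff eta (chart_at x) (row' i v)) (cmap (chart_at x) x) (row i v).

(* The wedge product along a pairing m of the coefficients, normalised by
   (a /\ b)(v_0, v_1) = m (a v_0) (b v_1) - m (a v_1) (b v_0) on 1-forms. *)
Definition wedge {V W Z : X -> lmodType C} (m : forall x, V x -> W x -> Z x)
    {p q : nat} (eta : vform p V) (theta : vform q W) : vform (p + q)%N Z :=
  fun x v => ((p`! * q`!)%N%:R : C)^-1 *:
    \sum_(s : 'S_(p + q)%N) ((-1) ^+ s : C) *:
      m x (eta x (usubmx (row_perm s v))) (theta x (dsubmx (row_perm s v))).

(* Holomorphically convex and holomorphically separable open submanifolds. *)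
Definition hol_hull (U K : set X) : set X :=
  [set x | U x /\ forall f, hol_fun U f ->
     forall M : C, (forall y, K y -> `|f y| <= M) -> `|f x| <= M].

Definition stein (U : set X) : Prop :=
  [/\ open U,
      forall K, K `<=` U -> compact K -> compact (hol_hull U K) &
      forall x y, U x -> U y -> x != y ->
        exists2 f, hol_fun U f & f x != f y].

End Forms.

(* A holomorphic vector bundle trivialised by U, that is with a holomorphic
   frame over each U a. Its rank is locally constant. *)
Record hol_bundle {R : realType} {X : complex_manifold R} {A : Type}
    (U : A -> set X) := {
  fibre :> X -> vectType (Cplx R);
  brank : A -> nat;
  frame : forall (a : A) (x : X), (brank a).-tuple (fibre x);
  frame_basis : forall a x, U a x -> basis_of fullv (frame a x);
  frame_hol : forall a b i j, hol_fun (U a `&` U b)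
    (fun x => coord (frame b x) i (tnth (frame a x) j))
}.
Arguments frame {R X A U} E a x : rename.
Arguments brank {R X A U} E a : rename.

Section Bundles.
Context {R : realType} {X : complex_manifold R} {A : Type} {U : A -> set X}.
Variable E : hol_bundle U.
Local Notation C := (Cplx R).

Definition section_of := forall x : X, E x.
Definition eform (q : nat) := vform q (fun x => E x).
Definition endform (q : nat) := vform q (fun x => 'End(E x)).

Definition frame_section {a : A} (i : 'I_(brank E a)) : section_of :=
  fun x => tnth (frame E a x) i.

Definition ecoord {q : nat} {a : A} (i : 'I_(brank E a)) (eta : eform q) :
  form q := fun x v => coord (frame E a x) i (eta x v).

Definition hol_section (V : set X) (s : section_of) : Prop :=
  forall a i, hol_fun (V `&` U a) (fun x => coord (frame E a x) i (s x)).

Definition hol_eform {q : nat} (V : set X) (eta : eform q) : Prop :=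
  forall a (i : 'I_(brank E a)), hol_form (V `&` U a) (ecoord i eta).

Definition hol_endform {q : nat} (V : set X) (eta : endform q) : Prop :=
  forall a i, hol_eform (V `&` U a)
    (fun x v => eta x v (@frame_section a i x)).

(* A morphism of sheaves is encoded by a map on set-theoretic sections, of which
   only the values on open sets where the argument is holomorphic matter;
   locality makes it induce maps on sections over open subsets of W. C-linearity
   is the Leibniz rule for constant functions. *)
Record hol_connection (W : set X) (nabla : section_of -> eform 1) : Prop := {
  conn_hol : forall V s, open V -> V `<=` W -> hol_section V s ->
    hol_eform V (nabla s);
  conn_local : forall V s t, open V -> V `<=` W ->
    hol_section V s -> hol_section V t -> (forall x, V x -> s x = t x) ->
    forall x v, V x -> nabla s x v = nabla t x v;
  conn_add : forall V s t, open V -> V `<=` W ->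
    hol_section V s -> hol_section V t ->
    forall x v, V x ->
      nabla (fun y => s y + t y) x v = nabla s x v + nabla t x v;
  conn_leibniz : forall V (f : X -> C) s, open V -> V `<=` W ->
    hol_fun V f -> hol_section V s ->
    forall x v, V x ->
      nabla (fun y => f y *: s y) x v =
        dR (fun0 f) x v *: s x + f x *: nabla s x v
}.

(* The extension of nabla to E-valued 1-forms over U a, given by
   nabla (e (x) eta) = nabla e /\ eta + e (x) d eta, evaluated on the
   decomposition \sum_i e_i (x) eta_i in the frame over U a. *)
Definition conn_ext (a : A) (nabla : section_of -> eform 1) (eta : eform 1) :
    eform 2 := fun x v =>
  \sum_(i < brank E a)
    (wedge (W := fun _ => C^o) (fun y (s : E y) (t : C^o) => t *: s)
        (nabla (frame_section i)) (ecoord i eta) x v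
     + dR (ecoord i eta) x v *: frame_section i x).

Definition flat_connection (a : A) (nabla : section_of -> eform 1) : Prop :=
  forall V s, open V -> V `<=` U a -> hol_section V s ->
  forall x v, V x -> conn_ext a nabla (nabla s) x v = 0.

(* omega = nabla' - nabla as a section over W of End(E) (x) Omega^1. *)
Definition conn_difference (W : set X) (nabla nabla' : section_of -> eform 1)
    (omega : endform 1) : Prop :=
  hol_endform W omega /\
  forall V s, open V -> V `<=` W -> hol_section V s ->
  forall x v, V x -> omega x v (s x) = nabla' s x v - nabla s x v.

Definition endmul {p q : nat} (eta : endform p) (theta : endform q) :
    endform (p + q)%N :=
  wedge (fun x (f g : 'End(E x)) => (f \o g)%VF) eta theta.

Definition lftrace {V : vectType C} (f : 'End(V)) : C :=
  \sum_i coord (vbasis fullv) i (f (tnth (vbasis fullv) i)).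

Definition trform {q : nat} (eta : endform q) : form q :=
  fun x v => lftrace (eta x v).

End Bundles.

Section Cech.
Context {R : realType} {X : complex_manifold R} {A : Type} (U : A -> set X).
Local Notation C := (Cplx R).

Definition inter {p : nat} (a : 'I_p.+1 -> A) : set X :=
  [set x | forall k, U (a k) x].

(* Forms are total on X; only the restriction of c a to inter a is meaningful,
   so cochains are compared there. *)
Definition cochain (p q : nat) (V : X -> lmodType C) :=
  ('I_p.+1 -> A) -> @vform R X q V.

Definition cochain_eq0 {p q V} (c : cochain p q V) : Prop :=
  forall a x v, inter a x -> c a x v = 0.

Definition cech_diff {p q V} (c : cochain p q V) : cochain p.+1 q V :=
  fun a x v => \sum_(k < p.+2) ((-1) ^+ k : C) *: c (a \o lift k) x v.

Definition omega_cochain (p q : nat) := cochain p q (fun _ => C^o).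

Definition hol_cochain {p q} (c : omega_cochain p q) : Prop :=
  forall a, hol_form (inter a) (c a).

(* Families indexed by all bidegrees, which avoids casts between the types of
   forms of degrees r.+1 - p and (r - p).+1. *)
Definition bicochain := forall p q : nat, omega_cochain p q.

Definition in_Tot (r : nat) (c : bicochain) : Prop :=
  forall p q, hol_cochain (c p q) /\ ((p + q)%N != r -> cochain_eq0 (c p q)).

Definition cech_part (c : bicochain) : bicochain := fun p q =>
  match p with
  | 0 => fun _ _ _ => 0
  | p'.+1 => cech_diff (c p' q)
  end.

Definition dR_part (c : bicochain) : bicochain := fun p q =>
  match q with
  | 0 => fun _ _ _ => 0
  | q'.+1 => fun a => dR (c p q' a)
  end.

Definition tot_diff (c : bicochain) : bicochain := fun p q a x v =>
  cech_part c p q a x v + (-1) ^+ p * dR_part c p q a x v.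

Definition tot_closed (c : bicochain) : Prop :=
  forall p q, cochain_eq0 (tot_diff c p q).

End Cech.

Section Atiyah.
Context {R : realType} {X : complex_manifold R} {A : Type} {U : A -> set X}.
Variables (E : hol_bundle U) (omega : A -> A -> endform E 1).
Local Notation C := (Cplx R).

Definition end_cochain (p q : nat) := @cochain R X A p q (fun x => 'End(E x)).

Definition end_cocycle {p q} (c : end_cochain p q) : Prop :=
  (forall a, hol_endform E (inter U a) (c a)) /\ cochain_eq0 U (cech_diff c).

Definition tr_cochain {p q} (c : end_cochain p q) : @omega_cochain R X A p q :=
  fun a => trform E (c a).

Definition atiyah2 : end_cochain 2 2 := fun a =>
  endmul E (omega (a (inord 0)) (a (inord 1))) (omega (a (inord 1)) (a (inord 2))).

Definition omega_cube : end_cochain 1 3 := fun a =>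
  let w := omega (a (inord 0)) (a (inord 1)) in endmul E (endmul E w w) w.

(* (0, tr (omega^3) / 3, tr (omega omega), 0, 0) *)
Definition atiyah2_tot : @bicochain R X A := fun p q =>
  match p, q return omega_cochain p q with
  | 1, 3 => fun a x v => 3%:R^-1 * tr_cochain omega_cube a x v
  | 2, 2 => tr_cochain atiyah2
  | _, _ => fun _ _ _ => 0
  end.

End Atiyah.

(* Main.v *)
Require Import Defs.
From mathcomp Require Import all_boot all_order all_algebra all_fingroup.
From mathcomp Require Import all_classical all_reals topology normedtype landau derive.
From mathcomp Require Import ring interval_inference.

Import Order.TTheory GRing.Theory Num.Theory.
Import numFieldNormedType.Exports.

Local Open Scope classical_set_scope.
Local Open Scope ring_scope.

(** In a holomorphic frame, and in a chart around a point, the connection nabla_a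
    is d + A_a for a matrix A_a of holomorphic 1-forms. Its flatness reads
    dA_a + A_a A_a = 0, and omega_ab becomes A_b - A_a. Put P = omega_ab and
    Q = omega_bc, so that omega_ac = P + Q.

    - Bidegree (3, 2): the additivity omega_ac = omega_ab + omega_bc makes
      omega_ab omega_bc a Cech cocycle, before any trace is taken
      (omega_cocycle).

    - Bidegree (2, 3): written with B = A_b, flatness gives
      dP = - B P - P B + P P and dQ = - B Q - Q B - Q Q. The terms in B cancel
      in d tr (P Q) by the graded cyclicity of the trace, which leaves
      d tr (P Q) = tr (P P Q) + tr (P Q Q) (derivative_trace_square). By
      cyclicity again this is a third of
      tr ((P + Q)^3) - tr (P^3) - tr (Q^3) (alt_tr3_cube_add), that is, minus
      the Cech differential of tr (omega^3) / 3.

    - Bidegree (1, 4): in the same way d tr (P^3) is a multiple of tr (P^4)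
      (derivative_trace_cube), which vanishes because a cyclic permutation of
      four 1-forms is odd (alt_tr4_diag).

    A product of 1-forms is evaluated on vectors, the rows of a matrix, by summing
    over the permutations of the rows with their signs: this is the operator
    alternation. The graded calculus above then takes place under this operator,
    where graded cyclicity is the invariance up to sign under a permutation of
    the rows, and where a term that is symmetric in two rows vanishes. The
    de Rham differential of an alternation is an alternation with one more row
    (dR_alternation). Finally flat_connmx brings all the connections to one
    frame: flatness of nabla_a is given in the frame over U_a, while the matrices
    A_a, A_b and A_c are compared in a single frame. *)

Local Notation nrow k u := (row (inord k) u).

(** * Alternation over the rows of a matrix *)

Section Alternation.
Context {K : numFieldType}.

Definition alternation {n d : nat} (F : 'M[K]_(n, d) -> K) (v : 'M[K]_(n, d)) : K :=
  \sum_(s : 'S_n) (-1) ^+ s * F (row_perm s v).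

(** The first half of alternating_multilinear, which the factors of a product
    pass on to it, unlike the second one. *)
Definition multilinear {n d : nat} (F : 'M[K]_(n, d) -> K) : Prop :=
  forall (A B D : 'M[K]_(n, d)) i t,
     row i A = t *: row i B + row i D ->
     row' i B = row' i A -> row' i D = row' i A -> F A = t * F B + F D.

Context {n d : nat}.
Implicit Types (F G : 'M[K]_(n, d) -> K) (v : 'M[K]_(n, d)).

Lemma eq_alternation {F} G v : F =1 G -> alternation F v = alternation G v.
Proof. by move=> FG; apply: eq_bigr => s _; rewrite FG. Qed.

Lemma alternationD F G v :
  alternation (fun u => F u + G u) v = alternation F v + alternation G v.
Proof. by rewrite -big_split; apply: eq_bigr => s _; rewrite mulrDr. Qed.

Lemma alternationZ k F v :
  alternation (fun u => k * F u) v = k * alternation F v.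
Proof. by rewrite mulr_sumr; apply: eq_bigr => s _; rewrite mulrCA. Qed.

Lemma alternationN F v : alternation (fun u => - F u) v = - alternation F v.
Proof. by rewrite -sumrN; apply: eq_bigr => s _; rewrite mulrN. Qed.

Lemma alternation_sum (I : finType) (F : I -> 'M[K]_(n, d) -> K) v :
  \sum_i alternation (F i) v = alternation (fun u => \sum_i F i u) v.
Proof.
by rewrite exchange_big; apply: eq_bigr => s _; rewrite mulr_sumr.
Qed.

Lemma alternation_row_perm (t : 'S_n) F v :
  alternation (fun u => F (row_perm t u)) v = (-1) ^+ t * alternation F v.
Proof.
rewrite /alternation mulr_sumr (reindex_inj (mulgI t^-1%g)) /=.
apply: eq_bigr => s _; rewrite -row_permM mulKVg mulrA -signr_addb.
by rewrite odd_permM odd_permV.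
Qed.

Lemma alternation_swap (i j : 'I_n) F v : i != j ->
  alternation (fun u => F (row_perm (tperm i j) u)) v = - alternation F v.
Proof. by move=> ij; rewrite alternation_row_perm odd_tperm ij mulN1r. Qed.

(** This is how flatness is used: it says that a certain expression in two of
    the vectors is symmetric, hence can be dropped under the alternation. *)
Lemma alternation_symmetric (i j : 'I_n) F v : i != j ->
  (forall u, F (row_perm (tperm i j) u) = F u) -> alternation F v = 0.
Proof.
move=> ij Fij; have := alternation_swap i j F v ij.
rewrite (eq_alternation _ _ Fij) => /eqP; rewrite -addr_eq0 -mulr2n.
by rewrite mulrn_eq0 /= => /eqP.
Qed.

Lemma row'_row (i : 'I_n) (A B : 'M[K]_(n, d)) :
  row' i A = row' i B <-> forall k, k != i -> row k A = row k B.
Proof.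
split=> [/matrixP AB k|AB].
  by case: (unliftP i k) => [k' ->|->]; rewrite ?eqxx // => _;
    apply/rowP => j; move: (AB k' j); rewrite !mxE.
apply/matrixP => k j; have ki : lift i k != i by rewrite eq_sym neq_lift.
by have /rowP/(_ j) := AB _ ki; rewrite !mxE.
Qed.

Lemma row_row_perm (s : 'S_n) (i : 'I_n) (A : 'M[K]_(n, d)) :
  row i (row_perm s A) = row (s i) A.
Proof. by apply/rowP => j; rewrite !mxE. Qed.

Lemma row_perm_mul (m : nat) (s : 'S_n) (A : 'M[K]_(n, d)) (B : 'M[K]_(d, m)) :
  row_perm s (A *m B) = row_perm s A *m B.
Proof.
by apply/matrixP => i j; rewrite !mxE; apply: eq_bigr => k _; rewrite mxE.
Qed.

(** Alternating a multilinear function yields an alternating one: exchanging two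
    equal rows fixes the argument and changes the sign of the sum. *)
Lemma alternation_alternating F : multilinear F ->
  alternating_multilinear (alternation F : _ -> K^o).
Proof.
move=> Flin; split=> [A B D i t Ai Bi Di|A i j ij Aij].
  rewrite /alternation /GRing.scale /= mulr_sumr -big_split /=.
  apply: eq_bigr => s _.
  have rowE (M : 'M[K]_(n, d)) : row' i M = row' i A ->
      row' (s^-1 i)%g (row_perm s M) = row' (s^-1 i)%g (row_perm s A).
    move=> /row'_row MA; apply/row'_row => k ki; rewrite !row_row_perm; apply: MA.
    by apply: contraNneq ki => <-; rewrite permK.
  rewrite (Flin _ (row_perm s B) (row_perm s D) (s^-1 i)%g t) ?rowE //.
    by rewrite mulrDr mulrCA.
  by rewrite !row_row_perm permKV.
apply/eqP; rewrite -[_ == 0](mulrn_eq0 _ 2) mulr2n addr_eq0; apply/eqP.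
have AE : row_perm (tperm i j) A = A.
  apply/row_matrixP => k; rewrite row_row_perm.
  by case: tpermP => [->|->|].
rewrite /alternation [LHS](reindex_inj (mulIg (tperm i j))) /= -sumrN.
apply: eq_bigr => s _.
by rewrite row_permM AE odd_permM odd_tperm ij addbT signrN mulNr.
Qed.

End Alternation.

(** * The algebra of traces of products of matrix-valued 1-forms *)

Lemma inord_eq n i j : (i <= n)%N -> (j <= n)%N ->
  (inord i == inord j :> 'I_n.+1) = (i == j).
Proof. by move=> ilt jlt; rewrite -val_eqE /= !inordK. Qed.

Section Words.
Context {K : numFieldType} {d r : nat}.
Implicit Types (X Y Z W A B C P Q : 'rV[K]_d -> 'M[K]_r)
  (DP DQ DW : 'rV[K]_d -> 'rV[K]_d -> 'M[K]_r).

(** The values of the 3-form tr (X Y Z) and, below, of the 4-form tr (X Y Z W). *)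
Definition alt_tr3 X Y Z (v : 'M[K]_(3, d)) : K :=
  alternation (fun u => \tr (X (nrow 0 u) *m Y (nrow 1 u) *m Z (nrow 2 u))) v.

Definition alt_tr4 X Y Z W (v : 'M[K]_(4, d)) : K :=
  alternation (fun u =>
    \tr (X (nrow 0 u) *m Y (nrow 1 u) *m Z (nrow 2 u) *m W (nrow 3 u))) v.

Lemma tperm_inord n a b c : (a <= n)%N -> (b <= n)%N -> (c <= n)%N ->
  tperm (inord a) (inord b) (inord c) =
  inord (if c == a then b else if c == b then a else c) :> 'I_n.+1.
Proof.
move=> an bn cn; have [->|ca] := eqVneq c a; first by rewrite tpermL.
have [->|cb] := eqVneq c b; first by rewrite tpermR.
by rewrite tpermD // inord_eq // eq_sym.
Qed.

(* Evaluates the rows of a matrix whose rows were exchanged by transpositions. *)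
Local Ltac permute_rows := rewrite ?row_row_perm ?tperm_inord //=.

(** A cyclic permutation of three rows is even, that of four rows is odd. *)
Lemma alt_tr3_cyclic X Y Z v : alt_tr3 X Y Z v = alt_tr3 Y Z X v.
Proof.
rewrite /alt_tr3.
rewrite -[RHS]opprK -(@alternation_swap _ _ _ (inord 1) (inord 2)) ?inord_eq //.
rewrite -(@alternation_swap _ _ _ (inord 0) (inord 1)) ?inord_eq //.
by apply: eq_alternation => u; permute_rows; rewrite -mulmxA mxtrace_mulC.
Qed.

Lemma alt_tr4_cyclic X Y Z W v : alt_tr4 X Y Z W v = - alt_tr4 Y Z W X v.
Proof.
rewrite /alt_tr4.
rewrite -(@alternation_swap _ _ _ (inord 2) (inord 3)) ?inord_eq //.
rewrite -[RHS]opprK -(@alternation_swap _ _ _ (inord 1) (inord 2)) ?inord_eq //.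
rewrite -(@alternation_swap _ _ _ (inord 0) (inord 1)) ?inord_eq //.
by apply: eq_alternation => u; permute_rows; rewrite -!mulmxA mxtrace_mulC !mulmxA.
Qed.

(** tr (X^4) vanishes, the cyclic permutation of four factors being odd. *)
Lemma alt_tr4_diag X v : alt_tr4 X X X X v = 0.
Proof.
have /eqP := alt_tr4_cyclic X X X X v.
by rewrite -addr_eq0 -mulr2n mulrn_eq0 /= => /eqP.
Qed.

(** The 3-form d tr (P Q), where DP u w stands for the derivative of P(w) along u.
    The hypotheses are dP = - B P - P B + P P and dQ = - B Q - Q B - Q Q. *)
Lemma derivative_trace_square B P Q DP DQ v :
  (forall u w, DP u w + (B u *m P w + P u *m B w - P u *m P w) =
               DP w u + (B w *m P u + P w *m B u - P w *m P u)) ->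
  (forall u w, DQ u w + (B u *m Q w + Q u *m B w + Q u *m Q w) =
               DQ w u + (B w *m Q u + Q w *m B u + Q w *m Q u)) ->
  alternation (fun u : 'M_(3, d) =>
     \tr (DP (nrow 0 u) (nrow 1 u) *m Q (nrow 2 u)) +
     \tr (P (nrow 1 u) *m DQ (nrow 0 u) (nrow 2 u))) v =
  alt_tr3 P P Q v + alt_tr3 P Q Q v.
Proof.
move=> symP symQ.
(* The index of the derivative and that of P are rows 0 and 1: adding the stated
   terms makes the first factor symmetric in these rows. *)
have DPE : alternation (fun u : 'M_(3, d) =>
     \tr (DP (nrow 0 u) (nrow 1 u) *m Q (nrow 2 u))) v =
    alt_tr3 P P Q v - alt_tr3 B P Q v - alt_tr3 P B Q v.
  apply/eqP; rewrite -subr_eq0 -!alternationN -!alternationD -alternationN.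
  rewrite -alternationD; apply/eqP.
  rewrite -(@alternation_symmetric _ _ _ (inord 0) (inord 1) (fun u : 'M_(3, d) =>
    \tr ((DP (nrow 0 u) (nrow 1 u) + (B (nrow 0 u) *m P (nrow 1 u) +
      P (nrow 0 u) *m B (nrow 1 u) - P (nrow 0 u) *m P (nrow 1 u))) *m
      Q (nrow 2 u))) v) ?inord_eq //; last first.
    by move=> u; permute_rows; rewrite symP.
  apply: eq_alternation => u; rewrite !mulmxDl !mulNmx !raddfD !raddfN /=.
  by ring.
(* Exchanging rows 0 and 1 first moves the derivative next to Q and costs the sign
   of d (P Q) = dP Q - P dQ. *)
have DQE : alternation (fun u : 'M_(3, d) =>
     \tr (P (nrow 1 u) *m DQ (nrow 0 u) (nrow 2 u))) v =
    alt_tr3 P Q Q v + alt_tr3 P B Q v + alt_tr3 P Q B v.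
  rewrite -[LHS]opprK -(@alternation_swap _ _ _ (inord 0) (inord 1)) ?inord_eq //.
  apply/eqP; rewrite -subr_eq0 -opprD oppr_eq0 -!alternationD; apply/eqP.
  rewrite -(@alternation_symmetric _ _ _ (inord 1) (inord 2) (fun u : 'M_(3, d) =>
    \tr (P (nrow 0 u) *m (DQ (nrow 1 u) (nrow 2 u) + (B (nrow 1 u) *m Q (nrow 2 u) +
      Q (nrow 1 u) *m B (nrow 2 u) + Q (nrow 1 u) *m Q (nrow 2 u))))) v)
    ?inord_eq //; last first.
    by move=> u; permute_rows; rewrite symQ.
  apply: eq_alternation => u; permute_rows; rewrite !mulmxDr !mulmxA !raddfD /=.
  by ring.
rewrite alternationD DPE DQE (alt_tr3_cyclic B).
by ring.
Qed.

(** The 4-form d tr (W^3), under the hypothesis dW = - A W - W A - W W. The terms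
    in A cancel in pairs by cyclicity of the trace, and what is left is a multiple
    of tr (W^4). *)
Lemma derivative_trace_cube A W DW v :
  (forall u w, DW u w + (A u *m W w + W u *m A w + W u *m W w) =
               DW w u + (A w *m W u + W w *m A u + W w *m W u)) ->
  alternation (fun u : 'M_(4, d) =>
     \tr (DW (nrow 0 u) (nrow 1 u) *m W (nrow 2 u) *m W (nrow 3 u)) +
     \tr (W (nrow 1 u) *m DW (nrow 0 u) (nrow 2 u) *m W (nrow 3 u)) +
     \tr (W (nrow 1 u) *m W (nrow 2 u) *m DW (nrow 0 u) (nrow 3 u))) v = 0.
Proof.
move=> symW.
have DW1 : alternation (fun u : 'M_(4, d) =>
     \tr (DW (nrow 0 u) (nrow 1 u) *m W (nrow 2 u) *m W (nrow 3 u))) v =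
    - (alt_tr4 A W W W v + alt_tr4 W A W W v + alt_tr4 W W W W v).
  apply/eqP; rewrite -subr_eq0 opprK -!alternationD; apply/eqP.
  rewrite -(@alternation_symmetric _ _ _ (inord 0) (inord 1) (fun u : 'M_(4, d) =>
    \tr ((DW (nrow 0 u) (nrow 1 u) + (A (nrow 0 u) *m W (nrow 1 u) +
      W (nrow 0 u) *m A (nrow 1 u) + W (nrow 0 u) *m W (nrow 1 u))) *m
      W (nrow 2 u) *m W (nrow 3 u))) v) ?inord_eq //; last first.
    by move=> u; permute_rows; rewrite symW.
  by apply: eq_alternation => u; rewrite !mulmxDl !raddfD /=; ring.
have DW2 : alternation (fun u : 'M_(4, d) =>
     \tr (W (nrow 1 u) *m DW (nrow 0 u) (nrow 2 u) *m W (nrow 3 u))) v =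
    alt_tr4 W A W W v + alt_tr4 W W A W v + alt_tr4 W W W W v.
  rewrite -[LHS]opprK -(@alternation_swap _ _ _ (inord 0) (inord 1)) ?inord_eq //.
  apply/eqP; rewrite -subr_eq0 -opprD oppr_eq0 -!alternationD; apply/eqP.
  rewrite -(@alternation_symmetric _ _ _ (inord 1) (inord 2) (fun u : 'M_(4, d) =>
    \tr (W (nrow 0 u) *m (DW (nrow 1 u) (nrow 2 u) + (A (nrow 1 u) *m W (nrow 2 u) +
      W (nrow 1 u) *m A (nrow 2 u) + W (nrow 1 u) *m W (nrow 2 u))) *m
      W (nrow 3 u))) v) ?inord_eq //; last first.
    by move=> u; permute_rows; rewrite symW.
  apply: eq_alternation => u; permute_rows.
  by rewrite !mulmxDr !mulmxDl !mulmxA !raddfD /=; ring.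
have DW3 : alternation (fun u : 'M_(4, d) =>
     \tr (W (nrow 1 u) *m W (nrow 2 u) *m DW (nrow 0 u) (nrow 3 u))) v =
    - (alt_tr4 W W A W v + alt_tr4 W W W A v + alt_tr4 W W W W v).
  rewrite -[LHS]opprK -(@alternation_swap _ _ _ (inord 0) (inord 1)) ?inord_eq //.
  rewrite -(@alternation_swap _ _ _ (inord 1) (inord 2)) ?inord_eq //.
  apply/eqP; rewrite -subr_eq0 opprK -!alternationD; apply/eqP.
  rewrite -(@alternation_symmetric _ _ _ (inord 2) (inord 3) (fun u : 'M_(4, d) =>
    \tr (W (nrow 0 u) *m W (nrow 1 u) *m (DW (nrow 2 u) (nrow 3 u) +
      (A (nrow 2 u) *m W (nrow 3 u) + W (nrow 2 u) *m A (nrow 3 u) +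
       W (nrow 2 u) *m W (nrow 3 u))))) v) ?inord_eq //; last first.
    by move=> u; permute_rows; rewrite symW.
  apply: eq_alternation => u; permute_rows.
  by rewrite !mulmxDr !mulmxA !raddfD /=; ring.
rewrite !alternationD DW1 DW2 DW3 (alt_tr4_cyclic A) alt_tr4_diag.
by ring.
Qed.

Lemma alt_tr3_cube_add P Q v :
  let S u := P u + Q u in
  alt_tr3 S S S v =
    alt_tr3 P P P v + 3%:R * (alt_tr3 P P Q v + alt_tr3 P Q Q v) + alt_tr3 Q Q Q v.
Proof.
move=> S.
have -> : alt_tr3 S S S v =
    alt_tr3 P P P v + alt_tr3 P P Q v + alt_tr3 P Q P v + alt_tr3 Q P P v +
    (alt_tr3 P Q Q v + alt_tr3 Q P Q v + alt_tr3 Q Q P v + alt_tr3 Q Q Q v).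
  rewrite -!alternationD; apply: eq_alternation => u.
  by rewrite /S !mulmxDl !mulmxDr !mulmxDl !raddfD /=; ring.
rewrite (alt_tr3_cyclic Q P P) (alt_tr3_cyclic P Q P) (alt_tr3_cyclic Q P P).
rewrite (alt_tr3_cyclic Q P Q) (alt_tr3_cyclic Q Q P) (alt_tr3_cyclic Q P Q).
by ring.
Qed.

End Words.

(** * Derivatives of matrices of functions *)

Section Calculus.
Context {K : numFieldType} {V : normedModType K}.

(** The difference f - g vanishes near x, so it is a little-o of the increment
    and its differential at x is 0. *)
Lemma is_diff_near (W : normedModType K) (f g df : V -> W) x :
  (\forall z \near x, f z = g z) -> is_diff x g df -> is_diff x f df.
Proof.
move=> fg gdf.
pose h := f - g.
have h0 : h x = 0 by rewrite /h !fctE (nbhs_singleton fg) subrr.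
have ho : h \o shift x = cst (h x) + 0 +o_ (0 : V) id.
  rewrite h0; apply/eqaddoP => _/posnumP[e].
  have : \forall z \near (0 : V), f (z + x) = g (z + x).
    have /= := fg; rewrite (near_shift 0) /=.
    by apply: filterS => z; rewrite subr0.
  apply: filterS => z fgz; rewrite !fctE /h /= !fctE fgz subrr addr0 subr0 normr0.
  by rewrite mulr_ge0.
have dh : ('d h x : V -> W) = 0.
  by apply/diff_unique => //; apply: cst_continuous.
have hd : is_diff x h 0.
  split=> //; apply/diff_locallyP; rewrite dh; split=> //.
  exact: cst_continuous.
have -> : f = g + h by rewrite /h addrC subrK.
by apply: is_diff_eq; rewrite addr0.
Qed.

Lemma is_diff_sum (I : Type) (s : seq I) (F dF : I -> V -> K) x :
  (forall i, is_diff x (F i) (dF i)) ->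
  is_diff x (fun z => \sum_(i <- s) F i z) (fun u => \sum_(i <- s) dF i u).
Proof.
move=> Fd; elim: s => [|i s IH].
  under eq_fun do rewrite big_nil.
  under [X in is_diff _ _ X]eq_fun do rewrite big_nil.
  exact: is_diff_cst.
under eq_fun do rewrite big_cons.
under [X in is_diff _ _ X]eq_fun do rewrite big_cons.
exact: is_diffD.
Qed.

Lemma is_diff_mul (f g : V -> K) x : differentiable f x -> differentiable g x ->
  is_diff x (fun z => f z * g z) (fun u => 'd f x u * g x + f x * 'd g x u).
Proof.
move=> fd gd; split; first exact: differentiableM.
rewrite (_ : (fun z => _) = f * g) // diffM //; apply/funext => u.
by rewrite !fctE /= /GRing.scale /= addrC (mulrC (g x)).
Qed.

Lemma is_diff_scale (k : K) (f df : V -> K) x : is_diff x f df ->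
  is_diff x (fun z => k * f z) (fun u => k * df u).
Proof. by move=> fd; apply: is_diffZ. Qed.

End Calculus.

Section MatrixCalculus.
Context {K : numFieldType} {V : normedModType K} {r : nat}.
Implicit Types (M N : V -> 'M[K]_r) (x : V).

Definition mx_differentiable M x := forall i j, differentiable (fun z => M z i j) x.

Definition mx_diff M x (u : V) : 'M[K]_r := \matrix_(i, j) 'd (fun z => M z i j) x u.

Lemma is_diff_mulmx M N x i j : mx_differentiable M x -> mx_differentiable N x ->
  is_diff x (fun z => (M z *m N z) i j)
    (fun u => (mx_diff M x u *m N x + M x *m mx_diff N x u) i j).
Proof.
move=> Md Nd.
under eq_fun do rewrite mxE.
under [X in is_diff _ _ X]eq_fun do rewrite mxE 2!mxE -big_split /=.
apply: is_diff_sum => k.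
under [X in is_diff _ _ X]eq_fun do rewrite !mxE.
exact: is_diff_mul.
Qed.

Lemma mx_differentiable_mul M N x :
  mx_differentiable M x -> mx_differentiable N x ->
  mx_differentiable (fun z => M z *m N z) x.
Proof. by move=> Md Nd i j; have [] := is_diff_mulmx M N x i j Md Nd. Qed.

Lemma mx_diff_mul M N x u : mx_differentiable M x -> mx_differentiable N x ->
  mx_diff (fun z => M z *m N z) x u = mx_diff M x u *m N x + M x *m mx_diff N x u.
Proof.
move=> Md Nd; apply/matrixP => i j.
by rewrite mxE (@diff_val _ _ _ _ _ _ _ (is_diff_mulmx M N x i j Md Nd)).
Qed.

Lemma mx_differentiable_sub M N x :
  mx_differentiable M x -> mx_differentiable N x ->
  mx_differentiable (fun z => M z - N z) x.
Proof.
move=> Md Nd i j; rewrite (_ : (fun z => _) = (fun z => M z i j) - (fun z => N z i j)).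
  exact: differentiableB.
by apply/funext => z; rewrite !mxE.
Qed.

Lemma mx_diff_sub M N x u : mx_differentiable M x -> mx_differentiable N x ->
  mx_diff (fun z => M z - N z) x u = mx_diff M x u - mx_diff N x u.
Proof.
move=> Md Nd; apply/matrixP => i j; rewrite !mxE.
rewrite (_ : (fun z => _) = (fun z => M z i j) - (fun z => N z i j)).
  by rewrite diffB.
by apply/funext => z; rewrite !mxE.
Qed.

Lemma is_diff_trace M x : mx_differentiable M x ->
  is_diff x (fun z => \tr (M z)) (fun u => \tr (mx_diff M x u)).
Proof.
move=> Md; apply: is_diff_sum => i.
under [X in is_diff _ _ X]eq_fun do rewrite mxE.
exact: differentiableP.
Qed.

End MatrixCalculus.

(** * The exterior derivative of an alternation *)

Section AlternationRecursion.
Context {K : numFieldType} {d : nat}.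

(** A permutation of n + 1 points is determined by the image of the first point
    and a permutation of the n remaining ones. *)
Lemma sum_lift_perm n (f : 'S_n.+1 -> K) :
  \sum_s f s = \sum_i \sum_t f (lift_perm ord0 i t).
Proof.
pose h (it : 'I_n.+1 * 'S_n) := lift_perm ord0 it.1 it.2.
have h_inj : injective h.
  move=> [i s] [j t] /permP E; have := E ord0; rewrite !lift_perm_id /= => ij.
  rewrite ij in E *; congr (_, _); apply/permP => k.
  by have := E (lift ord0 k); rewrite !lift_perm_lift => /lift_inj.
have h_bij : bijective h.
  apply: inj_card_bij h_inj _.
  by rewrite card_prod card_ord !card_Sn factS.
by rewrite pair_bigA (reindex h) //; apply: onW_bij.
Qed.

Lemma row_lift_perm n (i : 'I_n.+1) (t : 'S_n) (v : 'M[K]_(n.+1, d)) :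
  row ord0 (row_perm (lift_perm ord0 i t) v) = row i v.
Proof. by rewrite row_row_perm lift_perm_id. Qed.

Lemma row'_lift_perm n (i : 'I_n.+1) (t : 'S_n) (v : 'M[K]_(n.+1, d)) :
  row' ord0 (row_perm (lift_perm ord0 i t) v) = row_perm t (row' i v).
Proof. by apply/matrixP => k l; rewrite !mxE lift_perm_lift. Qed.

(** The expansion along the first row: the right-hand side has the shape of the
    formula for the exterior derivative, G playing the role of a derivative
    along its first argument. *)
Lemma alternation_expand n (G : 'rV[K]_d -> 'M[K]_(n, d) -> K) v :
  alternation (fun u : 'M_(n.+1, d) => G (row ord0 u) (row' ord0 u)) v =
  \sum_(i < n.+1) (-1) ^+ i * alternation (G (row i v)) (row' i v).
Proof.
rewrite /alternation sum_lift_perm; apply: eq_bigr => i _; rewrite mulr_sumr.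
apply: eq_bigr => t _; rewrite row_lift_perm row'_lift_perm odd_lift_perm /=.
by rewrite signr_addb mulrA signr_odd.
Qed.

Lemma sum_perm1 (f : 'S_1 -> K) : \sum_s f s = f 1%g.
Proof. by apply: big_pred1 => s; apply/esym/eqP/permP => i; rewrite !ord1. Qed.

Lemma alternation2 (F : 'M[K]_(2, d) -> K) v :
  alternation F v = F v - F (row_perm (tperm (inord 0) (inord 1)) v).
Proof.
have -> : tperm (inord 0) (inord 1) = lift_perm ord0 (lift ord0 ord0) 1%g :> 'S_2.
  have -> : inord 0 = ord0 :> 'I_2 by apply: val_inj; rewrite /= inordK.
  have -> : inord 1 = lift ord0 ord0 :> 'I_2 by apply: val_inj; rewrite /= inordK.
  apply/permP => k; case: (unliftP ord0 k) => [k' ->|->].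
    rewrite (ord1 k') tpermR.
    by rewrite lift_perm_lift perm1; apply: val_inj.
  by rewrite tpermL lift_perm_id.
rewrite /alternation sum_lift_perm big_ord_recl big_ord1 !sum_perm1 lift_perm1.
by rewrite odd_perm1 odd_lift_perm odd_perm1 row_perm1 /= mul1r mulN1r.
Qed.

(** Alternating in the first two rows beforehand only multiplies by 2, since a
    permutation of these two rows is absorbed in the outer sum. *)
Lemma alternation_nested2 (F : 'M[K]_(2, d) -> 'rV[K]_d -> K) (v : 'M[K]_(2 + 1, d)) :
  alternation (fun u : 'M_(2 + 1, d) =>
    alternation (F ^~ (dsubmx u)) (usubmx u)) v =
  2%:R * alternation (fun u : 'M_(2 + 1, d) => F (usubmx u) (dsubmx u)) v.
Proof.
pose t : 'S_(2 + 1) := tperm (inord 0) (inord 1).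
rewrite (eq_alternation (fun u : 'M_(2 + 1, d) => F (usubmx u) (dsubmx u) -
  F (usubmx (row_perm t u)) (dsubmx (row_perm t u)))) => [|u].
  rewrite alternationD alternationN.
  rewrite (alternation_swap _ _ (fun u => F (usubmx u) (dsubmx u))) ?inord_eq //.
  by rewrite opprK; ring.
rewrite alternation2; congr (_ - F _ _).
  apply/matrixP => i j; rewrite !mxE; congr (u _ j).
  have lshiftE k : (k <= 1)%N -> lshift 1 (inord k : 'I_2) = inord k :> 'I_3.
    by move=> k1; apply: val_inj; rewrite /= !inordK // ltnS ltnW.
  rewrite -(inord_val i); case: i => [[|[|//]] /= _];
    by rewrite /t tperm_inord //= !lshiftE ?tperm_inord.
apply/matrixP => i j; rewrite !mxE; congr (u _ j).
have -> : rshift 2 i = inord 2 :> 'I_3 by apply: val_inj; rewrite /= ord1 inordK.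
by rewrite /t tperm_inord.
Qed.

End AlternationRecursion.

Section DeRham.
Context {R : realType} {X : complex_manifold R}.
Local Notation C := (Cplx R).

(** If eta is the alternation of G near x, then d eta is the alternation of the
    derivative of G, with the direction of derivation as new first row. Only G
    has to be differentiated, and G is a plain product in the applications. *)
Lemma dR_alternation n (eta : @Defs.form R X n) (x : X)
    (G : 'rV[C]_(tdim x) -> 'M[C]_(n, tdim x) -> C)
    (dG : 'rV[C]_(tdim x) -> 'M[C]_(n, tdim x) -> C) :
  (forall w, \forall z \near cmap (chart_at x) x,
     coeff eta (chart_at x) w z = alternation (G z) w) ->
  (forall w, is_diff (cmap (chart_at x) x) (G ^~ w) (dG ^~ w)) ->
  forall v, dR eta x v =
    alternation (fun u : 'M_(n.+1, tdim x) => dG (row ord0 u) (row' ord0 u)) v.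
Proof.
move=> etaG GdG v; rewrite alternation_expand /dR.
apply: eq_bigr => i _; congr (_ * _).
have dalt : is_diff (cmap (chart_at x) x) (coeff eta (chart_at x) (row' i v))
    (fun u => alternation (dG u) (row' i v)).
  apply: is_diff_near (etaG _) _; apply: is_diff_sum.
by rewrite diff_val.
Qed.

End DeRham.

(** * Holomorphic forms *)

Section Multilinear.
Context {K : numFieldType} {d : nat}.

Lemma multilinear_alternating n (F : 'M[K]_(n, d) -> K^o) :
  alternating_multilinear F -> multilinear F.
Proof. by case. Qed.

Lemma multilinear_mul p q (F : 'M[K]_(p, d) -> K) (G : 'M[K]_(q, d) -> K) :
  multilinear F -> multilinear G ->
  multilinear (fun u : 'M_(p + q, d) => F (usubmx u) * G (dsubmx u)).
Proof.
move=> Flin Glin M B D i t Mi /row'_row BM /row'_row DM.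
have usubE (N : 'M[K]_(p + q, d)) k : row k (usubmx N) = row (lshift q k) N.
  by apply/rowP => j; rewrite !mxE.
have dsubE (N : 'M[K]_(p + q, d)) k : row k (dsubmx N) = row (rshift p k) N.
  by apply/rowP => j; rewrite !mxE.
case: (split_ordP i) => k ik; rewrite {i}ik in Mi BM DM.
  have dsub (N : 'M[K]_(p + q, d)) :
      (forall l, l != lshift q k -> row l N = row l M) -> dsubmx N = dsubmx M.
    by move=> NM; apply/row_matrixP => l; rewrite !dsubE NM // eq_rlshift.
  rewrite (dsub _ BM) (dsub _ DM) (Flin _ (usubmx B) (usubmx D) k t) ?usubE //.
  - by rewrite mulrDl mulrA.
  - by apply/row'_row => l lk; rewrite !usubE BM // eq_lshift.
  - by apply/row'_row => l lk; rewrite !usubE DM // eq_lshift.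
have usub (N : 'M[K]_(p + q, d)) :
    (forall l, l != rshift p k -> row l N = row l M) -> usubmx N = usubmx M.
  by move=> NM; apply/row_matrixP => l; rewrite !usubE NM // eq_lrshift.
rewrite (usub _ BM) (usub _ DM) (Glin _ (dsubmx B) (dsubmx D) k t) ?dsubE //.
- by rewrite mulrDr mulrCA.
- by apply/row'_row => l lk; rewrite !dsubE BM // eq_rshift.
- by apply/row'_row => l lk; rewrite !dsubE DM // eq_rshift.
Qed.

Lemma alternating_multilinear0 n :
  alternating_multilinear (fun _ : 'M[K]_(n, d) => 0 : K^o).
Proof. by split=> // A B D i t _ _ _; rewrite scaler0 addr0. Qed.

Lemma alternating_multilinearD n (F G : 'M[K]_(n, d) -> K^o) :
  alternating_multilinear F -> alternating_multilinear G ->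
  alternating_multilinear (fun u => F u + G u).
Proof.
move=> [Flin F0] [Glin G0]; split=> [A B D i t Ai Bi Di|A i j ij Aij].
  by rewrite (Flin A B D i t) // (Glin A B D i t) // scalerDr addrACA.
by rewrite (F0 A i j) // (G0 A i j) // addr0.
Qed.

Lemma alternating_multilinearZ n k (F : 'M[K]_(n, d) -> K^o) :
  alternating_multilinear F -> alternating_multilinear (fun u => k * F u : K^o).
Proof.
move=> [Flin F0]; split=> [A B D i t Ai Bi Di|A i j ij Aij].
  by rewrite (Flin A B D i t) // mulrDr /GRing.scale /= mulrCA.
by rewrite (F0 A i j) // mulr0.
Qed.

End Multilinear.

Section HolomorphicForms.
Context {R : realType} {X : complex_manifold R}.
Local Notation C := (Cplx R).
Implicit Types (V W : set X) (c : chart X).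

(** The wedge product of scalar forms; the matrix entries of a product of
    endomorphism-valued forms are sums of such products. *)
Definition swedge {p q} (eta : @Defs.form R X p) (theta : @Defs.form R X q) :
    @Defs.form R X (p + q)%N :=
  wedge (V := fun=> C^o) (W := fun=> C^o) (Z := fun=> C^o)
    (fun _ s t => s * t) eta theta.

Lemma cimage_nbhs V c z : open V -> (cmap c @` (V `&` cdom c)) z ->
  \forall z' \near z, (cmap c @` (V `&` cdom c)) z'.
Proof.
move=> Vo [x [Vx cx] xz].
have cz : (cmap c @` cdom c) z by exists x.
have Vz : \forall z' \near z, V (cinv c z').
  apply: (cinv_continuous R X c z cz).
  by rewrite -xz cmapK //; apply: open_nbhs_nbhs.
have cz' : \forall z' \near z, (cmap c @` cdom c) z'.
  by apply: open_nbhs_nbhs; split=> //; apply: cimage_open.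
apply: filterS2 Vz cz' => z' Vz' [y cy yz'].
by exists y => //; split=> //; rewrite -(cmapK R X c y) // yz'.
Qed.

Lemma cinv_cimage V c z : (cmap c @` (V `&` cdom c)) z -> V (cinv c z).
Proof. by move=> [x [Vx cx] <-]; rewrite cmapK. Qed.

Lemma hol_form_sub {q} {V} W (eta : @Defs.form R X q) :
  W `<=` V -> hol_form V eta -> hol_form W eta.
Proof.
move=> WV [alt hol]; split=> [x /WV|c v z [x [Wx cx] xz]]; first exact: alt.
by apply: hol; exists x => //; split=> //; apply: WV.
Qed.

(** The set has to be open: the derivatives of the coefficients at a point
    depend on their values around it. *)
Lemma hol_form_eq {q} V (eta theta : @Defs.form R X q) : open V ->
  (forall x v, V x -> eta x v = theta x v) -> hol_form V theta -> hol_form V eta.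
Proof.
move=> Vo E [alt hol]; split=> [x Vx|c v z cz].
  by rewrite (_ : eta x = theta x); [apply: alt|apply/funext => v; apply: E].
have := hol c v z cz => /differentiableP/is_diff_near hd.
suff /hd[] : \forall z' \near z, coeff eta c v z' = coeff theta c v z' by [].
apply: filterS (cimage_nbhs _ _ _ Vo cz) => z' /cinv_cimage Vz'.
exact: E.
Qed.

Lemma hol_form0 q V : hol_form V ((fun _ _ => 0) : @Defs.form R X q).
Proof.
split=> [x _|c v z _]; first exact: alternating_multilinear0.
exact: differentiable_cst.
Qed.

Lemma hol_form_sum q V (I : Type) (s : seq I) (eta : I -> @Defs.form R X q) :
  (forall i, hol_form V (eta i)) ->
  hol_form V (fun x v => \sum_(i <- s) eta i x v).
Proof.
move=> hol; split=> [x Vx|c v z cz].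
  elim: s => [|i s IH].
    by under eq_fun do rewrite big_nil; apply: alternating_multilinear0.
  under eq_fun do rewrite big_cons.
  by apply: alternating_multilinearD => //; have [alti _] := hol i; apply: alti.
suff [] : is_diff z (coeff (fun x v => \sum_(i <- s) eta i x v) c v)
  (fun u => \sum_(i <- s) 'd (coeff (eta i) c v) z u) by [].
apply: is_diff_sum => i; apply: differentiableP; have [_ holi] := hol i.
exact: holi.
Qed.

Lemma hol_formZ q V k (eta : @Defs.form R X q) :
  hol_form V eta -> hol_form V (fun x v => k * eta x v).
Proof.
move=> [alt hol]; split=> [x Vx|c v z cz].
  by apply: alternating_multilinearZ; apply: alt.
by apply: differentiableZ; apply: hol.
Qed.

Lemma hol_form_wedge p q V (eta : @Defs.form R X p) (theta : @Defs.form R X q) :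
  hol_form V eta -> hol_form V theta -> hol_form V (swedge eta theta).
Proof.
move=> [alte hole] [altt holt]; split=> [x Vx|c v z cz].
  have lin := multilinear_mul _ _ _ _ (multilinear_alternating _ _ (alte x Vx))
    (multilinear_alternating _ _ (altt x Vx)).
  exact: alternating_multilinearZ _ _ _ (alternation_alternating _ lin).
pose ce s := coeff eta c (usubmx (row_perm s v)).
pose ct s := coeff theta c (dsubmx (row_perm s v)).
have coeffE : coeff (swedge eta theta) c v = fun z' =>
    ((p`! * q`!)%N%:R : C)^-1 *
      \sum_(s : 'S_(p + q)) (-1) ^+ s * (ce s z' * ct s z').
  apply/funext => z'; congr (_ * _); apply: eq_bigr => s _.
  congr (_ * (_ * _)); rewrite /ce /ct /coeff row_perm_mul.
    by congr (eta _ _); rewrite mul_usub_mx.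
  by congr (theta _ _); rewrite mul_dsub_mx.
have term_diff (s : 'S_(p + q)) := is_diff_scale ((-1) ^+ s) _ _ _
  (is_diff_mul _ _ z (hole c (usubmx (row_perm s v)) z cz)
    (holt c (dsubmx (row_perm s v)) z cz)).
have := is_diff_scale ((p`! * q`!)%N%:R : C)^-1 _ _ _
  (is_diff_sum _ (index_enum _) _ _ z term_diff).
by rewrite -/ce -/ct coeffE => -[].
Qed.

End HolomorphicForms.

(** * Endomorphism-valued forms in a frame *)

Lemma lftrace_basis (C : fieldType) (V : vectType C) (m n : nat)
    (e : m.-tuple V) (e' : n.-tuple V) (phi : 'End(V)) :
  basis_of fullv e -> basis_of fullv e' ->
  \sum_i coord e i (phi (tnth e i)) = \sum_j coord e' j (phi (tnth e' j)).
Proof.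
move=> eb e'b.
have expand k (g : k.-tuple V) w : basis_of fullv g ->
    w = \sum_i coord g i w *: tnth g i.
  move=> gb; rewrite {1}(coord_basis gb (memvf w)).
  by apply: eq_bigr => i _; rewrite (tnth_nth 0).
transitivity (\sum_i \sum_j coord e' j (phi (tnth e i)) * coord e i (tnth e' j)).
  apply: eq_bigr => i _; rewrite {1}(expand _ _ (phi _) e'b) linear_sum /=.
  by apply: eq_bigr => j _; rewrite linearZ.
rewrite exchange_big /=; apply: eq_bigr => j _.
rewrite {2}(expand _ _ (tnth e' j) eb) !linear_sum /=.
by apply: eq_bigr => i _; rewrite !linearZ /= mulrC.
Qed.

Section Frames.
Context {R : realType} {X : complex_manifold R} {A : Type} {U : A -> set X}.
Variable E : hol_bundle U.
Local Notation C := (Cplx R).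
Implicit Types (a b f : A) (x : X).

Definition endmx f x (phi : 'End(E x)) : 'M[C]_(brank E f) :=
  \matrix_(i, j) coord (frame E f x) i (phi (tnth (frame E f x) j)).

Lemma frame_expand f x (e : E x) : U f x ->
  e = \sum_i coord (frame E f x) i e *: tnth (frame E f x) i.
Proof.
move=> fx; rewrite {1}(coord_basis (frame_basis U E f x fx) (memvf e)).
by apply: eq_bigr => i _; rewrite (tnth_nth 0).
Qed.

Lemma endmx_comp f x (phi psi : 'End(E x)) : U f x ->
  endmx f x (phi \o psi)%VF = endmx f x phi *m endmx f x psi.
Proof.
move=> fx; apply/matrixP => i j; rewrite !mxE comp_lfunE.
rewrite {1}(frame_expand f x (psi _) fx) !linear_sum /=.
by apply: eq_bigr => k _; rewrite !mxE !linearZ /= mulrC.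
Qed.

Lemma lftrace_endmx f x (phi : 'End(E x)) : U f x ->
  lftrace phi = \tr (endmx f x phi).
Proof.
move=> fx; rewrite /lftrace /mxtrace.
under [RHS]eq_bigr do rewrite mxE.
apply: lftrace_basis; first exact: vbasisP.
exact: frame_basis.
Qed.

Lemma eq_lfun_frame f x (phi psi : 'End(E x)) : U f x ->
  (forall j, phi (tnth (frame E f x) j) = psi (tnth (frame E f x) j)) -> phi = psi.
Proof.
move=> fx E'; apply/lfunP => e; rewrite (frame_expand f x e fx) !linear_sum.
by apply: eq_bigr => i _; rewrite !linearZ /= E'.
Qed.

(** The formula for the entries of a product of matrices, where the frame b in
    which the result is expanded may differ from the frame a in the middle. *)
Lemma ecoord_endmul p q (eta : endform E p) (theta : endform E q) a b
    (i : 'I_(brank E a)) (j : 'I_(brank E b)) x v : U a x ->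
  ecoord E j (fun y w => endmul E eta theta y w (frame_section E i y)) x v =
  \sum_(k < brank E a) swedge
    (ecoord E j (fun y w => eta y w (frame_section E k y)))
    (ecoord E k (fun y w => theta y w (frame_section E i y))) x v.
Proof.
move=> ax; rewrite /ecoord /endmul /swedge /wedge /frame_section.
rewrite scale_lfunE sum_lfunE linearZ linear_sum -scaler_sumr; congr (_ *: _).
rewrite exchange_big; apply: eq_bigr => s _; rewrite scale_lfunE linearZ.
rewrite -scaler_sumr; congr (_ *: _); rewrite comp_lfunE.
rewrite {1}(frame_expand a x (theta _ _ _) ax) !linear_sum /=.
by apply: eq_bigr => k _; rewrite !linearZ /= mulrC.
Qed.

Hypothesis U_open : forall a, open (U a).

Lemma hol_endform_mul p q (V : set X) (eta : endform E p) (theta : endform E q) :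
  open V -> hol_endform E V eta -> hol_endform E V theta ->
  hol_endform E V (endmul E eta theta).
Proof.
move=> Vo etah thetah a i b j.
apply: (hol_form_eq _ _ (fun x v => \sum_(k < brank E a) swedge
    (ecoord E j (fun y w => eta y w (frame_section E k y)))
    (ecoord E k (fun y w => theta y w (frame_section E i y))) x v)).
- by apply: openI => //; apply: openI.
- by move=> x v [[_ ax] _]; apply: ecoord_endmul.
apply: hol_form_sum => k; apply: hol_form_wedge; first exact: etah.
by apply: hol_form_sub (thetah a i a k) => x [[Vx ax] _].
Qed.

Lemma hol_trform p (V : set X) f (eta : endform E p) : open V -> V `<=` U f ->
  hol_endform E V eta -> hol_form V (trform E eta).
Proof.
move=> Vo Vf etah.
apply: (hol_form_eq _ _ (fun x v => \sum_(i < brank E f)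
    ecoord E i (fun y w => eta y w (frame_section E i y)) x v)) => //.
  move=> x v /Vf fx; rewrite /trform (lftrace_endmx f) //.
  by apply: eq_bigr => i _; rewrite mxE.
apply: hol_form_sum => i; apply: hol_form_sub (etah f i f i) => x Vx.
by split; [split=> //|]; apply: Vf.
Qed.

Lemma hol_endform_sub p (V W : set X) (eta : endform E p) : W `<=` V ->
  hol_endform E V eta -> hol_endform E W eta.
Proof.
move=> WV etah a i b j; apply: hol_form_sub (etah a i b j).
by move=> x [[Wx ax] bx]; split=> //; split=> //; apply: WV.
Qed.

Lemma row_usub_dsub d (u : 'M[C]_(1 + 1, d)) :
  usubmx u = nrow 0 u /\ dsubmx u = nrow 1 u.
Proof.
by split; apply/rowP => j; rewrite !mxE; congr (u _ j);
  apply: val_inj; rewrite /= inordK ?ord1.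
Qed.

Lemma row_usub3 d (u : 'M[C]_(1 + 1 + 1, d)) :
  [/\ nrow 0 (usubmx u) = nrow 0 u, nrow 1 (usubmx u) = nrow 1 u &
      dsubmx u = nrow 2 u].
Proof.
by split; apply/rowP => j; rewrite !mxE; congr (u _ j);
  apply: val_inj; rewrite /= !inordK ?ord1.
Qed.

Lemma endmx_alternation n f x (F : 'M[C]_(n, tdim x) -> 'End(E x)) k v i j :
  endmx f x (k *: \sum_(s : 'S_n) ((-1) ^+ s : C) *: F (row_perm s v)) i j =
  k * alternation (fun u => endmx f x (F u) i j) v.
Proof.
rewrite mxE scale_lfunE sum_lfunE linearZ linear_sum; congr (_ *: _).
by apply: eq_bigr => s _; rewrite scale_lfunE linearZ mxE.
Qed.

Lemma endmx_endmul p q f x (eta : endform E p) (theta : endform E q) v i j :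
  endmx f x (endmul E eta theta x v) i j = ((p`! * q`!)%N%:R : C)^-1 *
    alternation (fun u : 'M_(p + q, tdim x) =>
      endmx f x (eta x (usubmx u) \o theta x (dsubmx u))%VF i j) v.
Proof. exact: endmx_alternation. Qed.

Lemma endmx_endmul11 f x (eta theta : endform E 1) (v : 'M_(1 + 1, tdim x)) i j : U f x ->
  endmx f x (endmul E eta theta x v) i j =
  alternation (fun u : 'M_(2, tdim x) =>
    (endmx f x (eta x (nrow 0 u)) *m endmx f x (theta x (nrow 1 u))) i j) v.
Proof.
move=> fx; rewrite endmx_endmul mul1n invr1 mul1r.
apply: eq_alternation => u; have [-> ->] := row_usub_dsub _ u.
by rewrite endmx_comp.
Qed.

Lemma trform_mul f x (eta theta : endform E 1) (v : 'M_(1 + 1, tdim x)) : U f x ->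
  trform E (endmul E eta theta) x v =
  alternation (fun u : 'M_(2, tdim x) =>
    \tr (endmx f x (eta x (nrow 0 u)) *m endmx f x (theta x (nrow 1 u)))) v.
Proof.
move=> fx; rewrite /trform (lftrace_endmx f) // /mxtrace -alternation_sum.
by apply: eq_bigr => i _; apply: endmx_endmul11.
Qed.

(** The coefficient 1 / (2! 1!) of the outer product is compensated by the
    nested alternation over two of the three rows. *)
Lemma trform_cube f x (eta : endform E 1) (v : 'M_(1 + 1 + 1, tdim x)) : U f x ->
  trform E (endmul E (endmul E eta eta) eta) x v =
  alt_tr3 (fun u => endmx f x (eta x u)) (fun u => endmx f x (eta x u))
    (fun u => endmx f x (eta x u)) v.
Proof.
move=> fx; rewrite /trform (lftrace_endmx f) //.
pose M u := endmx f x (eta x u).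
pose F (w : 'M[C]_(2, tdim x)) u := \tr (M (nrow 0 w) *m M (nrow 1 w) *m M u).
transitivity ((2%:R : C)^-1 * alternation (fun u : 'M[C]_(2 + 1, tdim x) =>
    alternation (F ^~ (dsubmx u)) (usubmx u)) v).
  rewrite /mxtrace; under eq_bigr do rewrite endmx_endmul.
  rewrite -mulr_sumr alternation_sum; congr (_ * _); apply: eq_alternation => u.
  rewrite /F /mxtrace -alternation_sum; apply: eq_bigr => i _.
  rewrite endmx_comp // mxE.
  under eq_bigr do rewrite endmx_endmul11 // mulrC -alternationZ.
  rewrite alternation_sum; apply: eq_alternation => w; rewrite [RHS]mxE.
  by apply: eq_bigr => k _; rewrite mulrC.
rewrite alternation_nested2 mulKf ?pnatr_eq0 //.
apply: eq_alternation => u; have [u0 u1 ->] := row_usub3 _ u.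
by rewrite /F u0 u1.
Qed.

End Frames.

(** * The tangent space at a point *)

Section Points.
Context {R : realType} {X : complex_manifold R}.
Local Notation C := (Cplx R).

Definition pcoord (x : X) : 'rV[C]_(tdim x) := cmap (chart_at x) x.

Lemma cinv_pcoord x : cinv (chart_at x) (pcoord x) = x.
Proof. by rewrite cmapK //; apply: chart_atP. Qed.

Lemma pcoord_cimage (V : set X) x : V x ->
  (cmap (chart_at x) @` (V `&` cdom (chart_at x))) (pcoord x).
Proof. by move=> Vx; exists x => //; split=> //; apply: chart_atP. Qed.

(** At x, the chart chart_at x is compared with itself, and the jacobian of the
    change of coordinates is the identity. *)
Lemma coeff_pcoord q (eta : @Defs.form R X q) x v :
  coeff eta (chart_at x) v (pcoord x) = eta x v.
Proof.
rewrite /coeff.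
have E y : y = x ->
    eta y (v *m 'J (cmap (chart_at y) \o cinv (chart_at x)) (pcoord x)) =
    eta x (v *m 'J (cmap (chart_at x) \o cinv (chart_at x)) (pcoord x)).
  by move=> ->.
rewrite E ?cinv_pcoord // (_ : 'J _ _ = 1%:M) ?mulmx1 //.
have fid : \forall z \near pcoord x,
    (cmap (chart_at x) \o cinv (chart_at x)) z = z.
  apply: filterS (cimage_nbhs _ _ _ openT (pcoord_cimage setT x I)).
  by move=> z [y [_ cy] <-] /=; rewrite cmapK.
have df : is_diff (pcoord x) (cmap (chart_at x) \o cinv (chart_at x)) id.
  by apply: is_diff_near fid _.
by rewrite /jacobian diff_val; apply/matrixP => i j; rewrite !mxE eqxx /= eq_sym.
Qed.

(** A 0-form is a function of a matrix without rows, so the alternating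
    multilinearity is void. *)
Lemma hol_funP (V : set X) (f : X -> C) :
  hol_fun V f <-> forall c, hol_on (cmap c @` (V `&` cdom c)) (f \o cinv c).
Proof.
split=> [[_ hol] c|hol]; first exact: hol c 0.
by split=> [x _|c v]; [split=> [? ? ? []|? []]|exact: hol].
Qed.

Lemma hol_funM (V : set X) (f g : X -> C) :
  hol_fun V f -> hol_fun V g -> hol_fun V (fun x => f x * g x).
Proof.
move=> /hol_funP fh /hol_funP gh; apply/hol_funP => c z cz.
by apply: differentiableM; [apply: fh|apply: gh].
Qed.

Lemma dR_fun0 (f : X -> C) x (v : 'M_(1, tdim x)) :
  dR (fun0 f) x v = 'd (f \o cinv (chart_at x)) (pcoord x) v.
Proof. by rewrite /dR big_ord1 mul1r row_id. Qed.

End Points.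

(** * Connection matrices and flatness *)

Lemma row_pair {K : numFieldType} d (N : 'M[K]_(1 + 1, d)) :
  [/\ row ord0 N = usubmx N, row (lift ord0 ord0) N = dsubmx N,
      row' ord0 N = dsubmx N & row' (lift ord0 ord0) N = usubmx N].
Proof.
by split; apply/rowP => j; rewrite !mxE; congr (N _ j);
  apply: val_inj; rewrite /= ?ord1.
Qed.

Lemma submx_swap {K : numFieldType} d (N : 'M[K]_(1 + 1, d)) :
  let t := tperm (inord 0) (inord 1) : 'S_(1 + 1) in
  usubmx (row_perm t N) = dsubmx N /\ dsubmx (row_perm t N) = usubmx N.
Proof.
have E0 (i : 'I_1) : lshift 1 i = inord 0 :> 'I_2.
  by apply: val_inj; rewrite /= ord1 inordK.
have E1 (i : 'I_1) : rshift 1 i = inord 1 :> 'I_2.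
  by apply: val_inj; rewrite /= ord1 inordK.
by split; apply/rowP => j; rewrite !mxE E0 E1 tperm_inord.
Qed.

(** The covariant derivative of a 1-form with values in the bundle does not depend
    on the frame. Here g is the transition matrix, q and eta are the components of
    the form in the two frames, e and de (resp. p) the components of the vectors
    of the first frame (resp. of the derivatives of the second frame) under a
    fixed linear functional, the l-th coordinate in the second frame. The
    derivatives of g in eta = g q and in p cancel the discrepancy. *)
Lemma frame_change_derivative {K : numFieldType} {V : normedModType K} {m n : nat}
    (l : 'I_n) (x u : V) (g : 'I_m -> 'I_n -> V -> K) (q : 'I_n -> V -> K)
    (eta : 'I_m -> V -> K) (e de : 'I_m -> K) (p : 'I_n -> K) :
  (forall i, \forall z \near x, eta i z = \sum_k g i k z * q k z) ->
  (forall i k, differentiable (g i k) x) ->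
  (forall k, differentiable (q k) x) ->
  (forall k, \sum_i g i k x * e i = (l == k)%:R) ->
  (forall k, p k = \sum_i ('d (g i k) x u * e i + g i k x * de i)) ->
  \sum_i (eta i x * de i + 'd (eta i) x u * e i) =
  'd (q l) x u + \sum_k p k * q k x.
Proof.
move=> etaE gd qd ge pE.
have detaE i : is_diff x (eta i) (fun u => \sum_k ('d (g i k) x u * q k x +
    g i k x * 'd (q k) x u)).
  apply: is_diff_near (etaE i) _; apply: is_diff_sum => k.
  exact: is_diff_mul.
have -> : 'd (q l) x u = \sum_k \sum_i g i k x * e i * 'd (q k) x u.
  rewrite (bigD1 l) //= -mulr_suml ge eqxx mul1r big1 ?addr0 // => k /negPf kl.
  by rewrite -mulr_suml ge eq_sym kl mul0r.
rewrite -big_split /=.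
transitivity (\sum_i \sum_k (g i k x * e i * 'd (q k) x u +
    ('d (g i k) x u * e i + g i k x * de i) * q k x)).
  apply: eq_bigr => i _; rewrite (nbhs_singleton (etaE i)).
  rewrite (@diff_val _ _ _ _ _ _ _ (detaE i)) !mulr_suml -big_split.
  by apply: eq_bigr => k _ /=; ring.
rewrite exchange_big; apply: eq_bigr => k _.
by rewrite pE mulr_suml -big_split.
Qed.

Section Connections.
Context {R : realType} {X : complex_manifold R} {A : Type} {U : A -> set X}.
Variable E : hol_bundle U.
Hypothesis U_open : forall a, open (U a).
Local Notation C := (Cplx R).
Implicit Types (a b f : A) (x : X) (V : set X).

Lemma hol_section_frame f (k : 'I_(brank E f)) V : V `<=` U f ->
  hol_section E V (frame_section E k).
Proof.
move=> Vf b i; apply: hol_form_sub (frame_hol U E f b i k) => x [Vx bx].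
by split=> //; apply: Vf.
Qed.

Lemma hol_section0 V : hol_section E V (fun _ => 0).
Proof.
move=> b i; apply/hol_funP => c z _.
rewrite (_ : _ \o _ = cst 0); first exact: differentiable_cst.
by apply/funext => z'; rewrite /= linear0.
Qed.

Lemma hol_sectionZ V (g : X -> C) s : hol_fun V g -> hol_section E V s ->
  hol_section E V (fun y => g y *: s y).
Proof.
move=> gh sh b i.
have -> : (fun x => coord (frame E b x) i (g x *: s x)) =
          (fun x => g x * coord (frame E b x) i (s x)).
  by apply/funext => x; rewrite linearZ.
by apply: hol_funM (sh b i); apply: hol_form_sub gh => x [].
Qed.

Lemma hol_sectionD V s t : hol_section E V s -> hol_section E V t ->
  hol_section E V (fun y => s y + t y).
Proof.
move=> sh th b i.
have -> : (fun x => coord (frame E b x) i (s x + t x)) =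
          (fun x => coord (frame E b x) i (s x) + coord (frame E b x) i (t x)).
  by apply/funext => x; rewrite linearD.
have /hol_funP sh' := sh b i; have /hol_funP th' := th b i.
by apply/hol_funP => c z cz; apply: differentiableD; [apply: sh'|apply: th'].
Qed.

Section OneConnection.
Variables (W : set X) (nabla : section_of E -> eform E 1).
Hypothesis conn : hol_connection E W nabla.

Lemma connection0 V x v : open V -> V `<=` W -> V x ->
  nabla (fun _ => 0) x v = 0.
Proof.
move=> Vo VW Vx; have h0 := hol_section0 V.
have := conn_add _ _ _ conn V _ _ Vo VW h0 h0 x v Vx.
rewrite (_ : (fun y => 0 + 0) = (fun y => 0)); last first.
  by apply: functional_extensionality_dep => y; rewrite addr0.
by move/eqP; rewrite -{1}[nabla _ x v]addr0 (inj_eq (addrI _)) => /eqP.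
Qed.

Lemma connection_sum V (I : Type) (r : seq I) (g : I -> X -> C)
    (s : I -> section_of E) :
  open V -> V `<=` W ->
  (forall i, hol_fun V (g i)) -> (forall i, hol_section E V (s i)) ->
  hol_section E V (fun y => \sum_(i <- r) g i y *: s i y) /\
  forall x v, V x ->
  nabla (fun y => \sum_(i <- r) g i y *: s i y) x v =
  \sum_(i <- r) (dR (fun0 (g i)) x v *: s i x + g i x *: nabla (s i) x v).
Proof.
move=> Vo VW gh sh; elim: r => [|i r [IHh IH]].
  rewrite (_ : (fun y => _) = (fun y => 0)); last first.
    by apply: functional_extensionality_dep => y; rewrite big_nil.
  by split=> [|x v Vx]; [exact: hol_section0|rewrite big_nil (connection0 V)].
rewrite (_ : (fun y => _) =
    (fun y => g i y *: s i y + \sum_(i <- r) g i y *: s i y)); last first.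
  by apply: functional_extensionality_dep => y; rewrite big_cons.
have ish := hol_sectionZ V (g i) (s i) (gh i) (sh i).
split=> [|x v Vx]; first exact: hol_sectionD.
rewrite (conn_add _ _ _ conn V) // (conn_leibniz _ _ _ conn V) // IH //.
by rewrite big_cons.
Qed.

(** The matrix A of the connection nabla = d + A in the frame over U f, at the
    point x; chart_connmx is its expression in the chart c. *)
Definition connmx f x (u : 'rV[C]_(tdim x)) : 'M[C]_(brank E f) :=
  \matrix_(i, j) ecoord E i (nabla (frame_section E j)) x u.

Definition chart_connmx f (c : chart X) (u z : 'rV[C]_(cdim c)) : 'M[C]_(brank E f) :=
  \matrix_(i, j) coeff (ecoord E i (nabla (frame_section E j))) c u z.

End OneConnection.

Definition transition a f (i : 'I_(brank E a)) (k : 'I_(brank E f)) (x : X) : C :=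
  coord (frame E a x) i (tnth (frame E f x) k).

Lemma hol_transition a f i k : hol_fun (U a `&` U f) (transition a f i k).
Proof. by rewrite setIC; apply: frame_hol. Qed.

Section Flatness.
Variables (a : A) (nabla : section_of E -> eform E 1).
Hypothesis conn : hol_connection E (U a) nabla.

Lemma connection_frame_change f (k : 'I_(brank E f)) x v : U a x -> U f x ->
  nabla (frame_section E k) x v =
  \sum_(i < brank E a)
    (dR (fun0 (transition a f i k)) x v *: frame_section E i x +
     transition a f i k x *: nabla (frame_section E i) x v).
Proof.
move=> ax fx.
have Vo : open (U a `&` U f) by apply: openI.
have Va : U a `&` U f `<=` U a by move=> y [].
have [sumh <- //] := connection_sum _ _ conn (U a `&` U f) _ (index_enum _)
  (fun i => transition a f i k) (fun i => frame_section E i) Vo Va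
  (fun i => hol_transition a f i k) (fun i => hol_section_frame a i _ Va).
apply: (conn_local _ _ _ conn (U a `&` U f)) => //.
  by apply: hol_section_frame => y [].
by move=> y [ay _]; rewrite {1}(frame_expand E a y (frame_section E k y) ay).
Qed.

Lemma hol_connmx f (i j : 'I_(brank E f)) :
  hol_form (U a `&` U f) (ecoord E i (nabla (frame_section E j))).
Proof.
have Vo : open (U a `&` U f) by apply: openI.
have Va : U a `&` U f `<=` U a by move=> y [].
have sh : hol_section E (U a `&` U f) (frame_section E j).
  by apply: hol_section_frame => y [].
apply: hol_form_sub (conn_hol _ _ _ conn _ _ Vo Va sh f i).
by move=> y [ay fy].
Qed.

Lemma differentiable_connmx f x u : U a x -> U f x ->
  mx_differentiable (chart_connmx nabla f (chart_at x) u) (pcoord x).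
Proof.
move=> ax fx i j; have [_ hol] := hol_connmx f i j.
under eq_fun do rewrite mxE.
exact: hol (pcoord_cimage _ x (conj ax fx)).
Qed.

Hypothesis flat : flat_connection E a nabla.

(** Evaluated on two vectors u and w, the equation dA + A A = 0 says that
    D_u A(w) + A(u) A(w) is symmetric in u and w. It holds in the frame over any
    U f, whereas the curvature is defined with the frame over U a. *)
Lemma flat_connmx f x (u w : 'rV[C]_(tdim x)) : U a x -> U f x ->
  let M := chart_connmx nabla f (chart_at x) in
  mx_diff (M w) (pcoord x) u + M u (pcoord x) *m M w (pcoord x) =
  mx_diff (M u) (pcoord x) w + M w (pcoord x) *m M u (pcoord x).
Proof.
move=> ax fx M; apply/matrixP => l j.
have Vo : open (U a `&` U f) by apply: openI.
have Va : U a `&` U f `<=` U a by move=> y [].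
have jh : hol_section E (U a `&` U f) (frame_section E j).
  by apply: hol_section_frame => y [].
pose eta (i : 'I_(brank E a)) := ecoord E i (nabla (frame_section E j)).
pose L : E x -> C := coord (frame E f x) l.
pose z := pcoord x.
(* The l-th coordinate of nabla_u (nabla_w e_j), expanded in the frame over U a;
   the curvature is its antisymmetrisation in u and w. *)
pose T (u w : 'rV[C]_(tdim x)) : C := \sum_(i < brank E a)
  (coeff (eta i) (chart_at x) w z * L (nabla (frame_section E i) x u) +
   'd (coeff (eta i) (chart_at x) w) z u * L (frame_section E i x)).
have Lsum (I : finType) (F : I -> E x) : L (\sum_i F i) = \sum_i L (F i).
  exact: linear_sum.
have LD e e' : L (e + e') = L e + L e' by exact: linearD.
have LZ k e : L (k *: e) = k * L e by exact: linearZ.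
have extE : L (conn_ext E a nabla (nabla (frame_section E j)) x (col_mx u w)) =
    T u w - T w u.
  rewrite /conn_ext /T -sumrB Lsum; apply: eq_bigr => i _.
  rewrite LD [X in _ + X = _]LZ.
  have -> : dR (eta i) x (col_mx u w) =
      'd (coeff (eta i) (chart_at x) w) (pcoord x) u -
      'd (coeff (eta i) (chart_at x) u) (pcoord x) w.
    rewrite /dR big_ord_recl big_ord1 mul1r mulN1r.
    by have [-> -> -> ->] := row_pair _ (col_mx u w); rewrite col_mxKu col_mxKd.
  have wedgeE : L (wedge (W := fun=> C^o) (fun y (s : E y) (t : C^o) => t *: s)
      (nabla (frame_section E i)) (eta i) x (col_mx u w)) =
      eta i x w * L (nabla (frame_section E i) x u) -
      eta i x u * L (nabla (frame_section E i) x w).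
    pose F (m : 'M[C]_(1 + 1, tdim x)) :=
      eta i x (dsubmx m) * L (nabla (frame_section E i) x (usubmx m)).
    transitivity (((1`! * 1`!)%N%:R : C)^-1 * alternation F (col_mx u w)).
      rewrite /wedge LZ Lsum; congr (_ * _).
      by apply: eq_bigr => s _; rewrite !LZ.
    rewrite invr1 mul1r alternation2 /F.
    by have [-> ->] := submx_swap _ (col_mx u w); rewrite col_mxKu col_mxKd.
  by rewrite [X in X + _ = _]wedgeE !coeff_pcoord; ring.
pose g i k := transition a f i k \o cinv (chart_at x).
pose q w' (k : 'I_(brank E f)) :=
  coeff (ecoord E k (nabla (frame_section E j))) (chart_at x) w'.
have gd i k : differentiable (g i k) z.
  have /hol_funP := hol_transition a f i k.
  by move=> /(_ _ _ (pcoord_cimage _ x (conj ax fx))).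
have qd w' k : differentiable (q w' k) z.
  have [_ hol] := hol_connmx f k j.
  exact: hol (pcoord_cimage _ x (conj ax fx)).
have gz i k : g i k z = transition a f i k x by rewrite /g /= cinv_pcoord.
have near_eta w' i : \forall z' \near z, coeff (eta i) (chart_at x) w' z' =
    \sum_k g i k z' * q w' k z'.
  apply: filterS (cimage_nbhs _ _ _ Vo (pcoord_cimage _ x (conj ax fx))).
  move=> z' /cinv_cimage[_ fz]; rewrite /q /coeff /eta /ecoord.
  rewrite {1}(frame_expand E f _ (nabla _ _ _) fz) linear_sum.
  by apply: eq_bigr => k _; rewrite linearZ mulrC.
have frameE (k : 'I_(brank E f)) : \sum_i g i k z * L (frame_section E i x) = (l == k)%:R.
  have <- : L (frame_section E k x) = (l == k)%:R.
    rewrite /L /frame_section (tnth_nth 0) coord_free 1?eq_sym //.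
    exact: basis_free (frame_basis U E f x fx).
  rewrite [in RHS](frame_expand E a x (frame_section E k x) ax) Lsum.
  by apply: eq_bigr => i _; rewrite LZ gz.
have ME u' k : M u' z l k = \sum_i ('d (g i k) z u' * L (frame_section E i x) +
    g i k z * L (nabla (frame_section E i) x u')).
  rewrite mxE coeff_pcoord /ecoord -/(L _) connection_frame_change // Lsum.
  by apply: eq_bigr => i _; rewrite LD !LZ dR_fun0 gz.
have TE (u' w' : 'rV[C]_(tdim x)) :
    T u' w' = (mx_diff (M w') z u' + M u' z *m M w' z) l j.
  have sumE := frame_change_derivative l z u' g (q w') _ _ _ _ (near_eta w') gd (qd w')
    frameE (ME u').
  rewrite [RHS]mxE [X in _ = X + _]mxE [X in _ = _ + X]mxE.
  under [X in 'd X _ _]eq_fun do rewrite mxE.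
  under [X in _ + X]eq_bigr do rewrite [X in _ * X]mxE.
  exact: sumE.
have flat0 := congr1 L (flat _ _ Vo Va jh x (col_mx u w) (conj ax fx)).
have L0 : L 0 = 0 by exact: linear0.
by move: (etrans (esym extE) (etrans flat0 L0)) => /subr0_eq; rewrite !TE.
Qed.

End Flatness.

End Connections.

(** * The difference of two flat connections *)

Section CurvatureOfDifference.
Context {K : numFieldType} {V : Type} {r : nat}.
Variables (A B : V -> 'M[K]_r) (DA DB : V -> V -> 'M[K]_r).
Hypothesis flatA : forall u w, DA u w + A u *m A w = DA w u + A w *m A u.
Hypothesis flatB : forall u w, DB u w + B u *m B w = DB w u + B w *m B u.

(** With P = B - A, the equations of A and B combine to
    dP = A A - B B = - A P - P A - P P; the next lemma is the same computation
    with A eliminated instead of B, dP = - B P - P B + P P. *)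
Lemma difference_curvature_source u w :
  let P v := B v - A v in
  DB u w - DA u w + (A u *m P w + P u *m A w + P u *m P w) =
  DB w u - DA w u + (A w *m P u + P w *m A u + P w *m P u).
Proof.
move=> P.
have E u' w' : DB u' w' - DA u' w' + (A u' *m P w' + P u' *m A w' + P u' *m P w') =
    (DB u' w' + B u' *m B w') - (DA u' w' + A u' *m A w').
  rewrite /P !mulmxBl !mulmxBr; set BB := B u' *m B w'; set AB := A u' *m B w'.
  set BA := B u' *m A w'; set AA := A u' *m A w'.
  by apply/matrixP => i j; rewrite !mxE; ring.
by rewrite !E flatA flatB.
Qed.

Lemma difference_curvature_target u w :
  let P v := B v - A v in
  DB u w - DA u w + (B u *m P w + P u *m B w - P u *m P w) =
  DB w u - DA w u + (B w *m P u + P w *m B u - P w *m P u).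
Proof.
move=> P.
have E u' w' : DB u' w' - DA u' w' + (B u' *m P w' + P u' *m B w' - P u' *m P w') =
    (DB u' w' + B u' *m B w') - (DA u' w' + A u' *m A w').
  rewrite /P !mulmxBl !mulmxBr; set BB := B u' *m B w'; set AB := A u' *m B w'.
  set BA := B u' *m A w'; set AA := A u' *m A w'.
  by apply/matrixP => i j; rewrite !mxE; ring.
by rewrite !E flatA flatB.
Qed.

End CurvatureOfDifference.

Lemma row'_ord0 {K : numFieldType} {n d} (u : 'M[K]_(n.+2, d)) k : (k <= n)%N ->
  nrow k (row' ord0 u) = nrow k.+1 u.
Proof.
move=> kn; apply/rowP => j; rewrite !mxE; congr (u _ j).
by apply: val_inj; rewrite /= !inordK.
Qed.

Lemma row_ord0 {K : numFieldType} {n d} (u : 'M[K]_(n.+1, d)) : row ord0 u = nrow 0 u.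
Proof. by congr row; apply: val_inj; rewrite /= inordK. Qed.

Lemma middle_summand {V : zmodType} (s p t q : V) : s = p + t + q -> t = s - p - q.
Proof. by move=> ->; rewrite addrAC addrK addrC addKr. Qed.

Section FlatMatrices.
Context {K : numFieldType} {d r : nat} (z : 'rV[K]_d).
Implicit Types (A B C : 'rV[K]_d -> 'rV[K]_d -> 'M[K]_r).

(** The 1-form A is recorded by the functions A w of its values on the constant
    vector fields w, and flat_at is the equation dA + A A = 0 at the point z. *)
Definition flat_at A :=
  (forall w, mx_differentiable (A w) z) /\
  forall u w, mx_diff (A w) z u + A u z *m A w z = mx_diff (A u) z w + A w z *m A u z.

(** The function dG is the derivative of the product inside the alternation that
    gives tr (P Q), in the form in which dR_alternation consumes it. *)
Lemma derivative_trace_square_flat A B C :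
  flat_at A -> flat_at B -> flat_at C ->
  let P w z' := B w z' - A w z' in let Q w z' := C w z' - B w z' in
  exists2 dG : 'rV[K]_d -> 'M[K]_(2, d) -> K,
    forall w, is_diff z (fun z' => \tr (P (nrow 0 w) z' *m Q (nrow 1 w) z')) (dG ^~ w) &
    forall v, alternation (fun u : 'M_(3, d) => dG (row ord0 u) (row' ord0 u)) v =
      alt_tr3 (P ^~ z) (P ^~ z) (Q ^~ z) v + alt_tr3 (P ^~ z) (Q ^~ z) (Q ^~ z) v.
Proof.
move=> [Ad Aflat] [Bd Bflat] [Cd Cflat] P Q.
have Pd w : mx_differentiable (P w) z by apply: mx_differentiable_sub.
have Qd w : mx_differentiable (Q w) z by apply: mx_differentiable_sub.
exists (fun u w => \tr (mx_diff (P (nrow 0 w)) z u *m Q (nrow 1 w) z) +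
                   \tr (P (nrow 0 w) z *m mx_diff (Q (nrow 1 w)) z u)) => [w|v].
  have PQ := is_diff_trace _ _ (mx_differentiable_mul _ _ _
    (Pd (nrow 0 w)) (Qd (nrow 1 w))).
  apply: is_diff_eq PQ _; apply/funext => u.
  by rewrite mx_diff_mul // raddfD.
rewrite -(derivative_trace_square (B ^~ z) _ _
  (fun u w => mx_diff (P w) z u) (fun u w => mx_diff (Q w) z u)).
- by apply: eq_alternation => u; rewrite row_ord0 !row'_ord0.
- move=> u w; rewrite !mx_diff_sub //.
  exact: (difference_curvature_target (A ^~ z) (B ^~ z)
    (fun u w => mx_diff (A w) z u) (fun u w => mx_diff (B w) z u)).
- move=> u w; rewrite !mx_diff_sub //.
  exact: (difference_curvature_source (B ^~ z) (C ^~ z)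
    (fun u w => mx_diff (B w) z u) (fun u w => mx_diff (C w) z u)).
Qed.

Lemma derivative_trace_cube_flat A B k :
  flat_at A -> flat_at B ->
  let P w z' := B w z' - A w z' in
  exists2 dG : 'rV[K]_d -> 'M[K]_(3, d) -> K,
    forall w, is_diff z (fun z' =>
      k * \tr (P (nrow 0 w) z' *m P (nrow 1 w) z' *m P (nrow 2 w) z')) (dG ^~ w) &
    forall v, alternation (fun u : 'M_(4, d) => dG (row ord0 u) (row' ord0 u)) v = 0.
Proof.
move=> [Ad Aflat] [Bd Bflat] P.
have Pd w : mx_differentiable (P w) z by apply: mx_differentiable_sub.
exists (fun u w => k *
  (\tr (mx_diff (P (nrow 0 w)) z u *m P (nrow 1 w) z *m P (nrow 2 w) z) +
   \tr (P (nrow 0 w) z *m mx_diff (P (nrow 1 w)) z u *m P (nrow 2 w) z) +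
   \tr (P (nrow 0 w) z *m P (nrow 1 w) z *m mx_diff (P (nrow 2 w)) z u))) => [w|v].
  apply: is_diff_scale.
  have PPd := mx_differentiable_mul _ _ _ (Pd (nrow 0 w)) (Pd (nrow 1 w)).
  have PPP := is_diff_trace _ _ (mx_differentiable_mul _ _ _ PPd (Pd (nrow 2 w))).
  apply: is_diff_eq PPP _; apply/funext => u.
  by rewrite !mx_diff_mul // mulmxDl !raddfD.
rewrite alternationZ -[RHS](mulr0 k); congr (_ * _).
rewrite -(derivative_trace_cube (A ^~ z) (P ^~ z) (fun u w => mx_diff (P w) z u) v).
  by apply: eq_alternation => u; rewrite row_ord0 !row'_ord0.
move=> u w; rewrite !mx_diff_sub //.
exact: (difference_curvature_source (A ^~ z) (B ^~ z)
  (fun u w => mx_diff (A w) z u) (fun u w => mx_diff (B w) z u)).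
Qed.

Lemma alt_tr3_cocycle A B C v :
  let P w z' := B w z' - A w z' in let Q w z' := C w z' - B w z' in
  let S w z' := C w z' - A w z' in
  alt_tr3 (S ^~ z) (S ^~ z) (S ^~ z) v =
  alt_tr3 (P ^~ z) (P ^~ z) (P ^~ z) v +
  3%:R * (alt_tr3 (P ^~ z) (P ^~ z) (Q ^~ z) v + alt_tr3 (P ^~ z) (Q ^~ z) (Q ^~ z) v) +
  alt_tr3 (Q ^~ z) (Q ^~ z) (Q ^~ z) v.
Proof.
move=> P Q S; rewrite -alt_tr3_cube_add; apply: eq_alternation => u.
have SD w : S w z = P w z + Q w z by rewrite /S /P /Q [RHS]addrC addrA subrK.
by rewrite !SD.
Qed.

End FlatMatrices.

Lemma alternation_mulmx {K : numFieldType} n d m (F : 'M[K]_(n, m) -> K)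
    (J : 'M[K]_(d, m)) v :
  alternation F (v *m J) = alternation (fun u => F (u *m J)) v.
Proof. by apply: eq_bigr => s _; rewrite row_perm_mul. Qed.

Section Differences.
Context {R : realType} {X : complex_manifold R} {A : Type} {U : A -> set X}.
Variable E : hol_bundle U.
Local Notation C := (Cplx R).
Hypothesis U_open : forall a, open (U a).
Variables (nabla : A -> section_of E -> eform E 1) (omega : A -> A -> endform E 1).
Hypothesis nabla_conn : forall a, hol_connection E (U a) (nabla a).
Hypothesis nabla_flat : forall a, flat_connection E a (nabla a).
Hypothesis omegaE : forall a b,
  conn_difference E (U a `&` U b) (nabla a) (nabla b) (omega a b).

Lemma endmx_omega a b f x u : U a x -> U b x -> U f x ->
  endmx E f x (omega a b x u) =
  connmx E (nabla b) f x u - connmx E (nabla a) f x u.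
Proof.
move=> ax bx fx; apply/matrixP => i j; rewrite !mxE /ecoord.
have [_ /(_ (U a `&` U b `&` U f) (frame_section E j)) omegaj] := omegaE a b.
rewrite omegaj ?linearB //.
- by apply: openI => //; apply: openI.
- by apply: hol_section_frame => y [].
Qed.

(** Both sides are nabla_c - nabla_a; as endomorphisms of the fibre they are
    compared on a frame. *)
Lemma omega_cocycle a b c x u : U a x -> U b x -> U c x ->
  omega a c x u = omega a b x u + omega b c x u.
Proof.
move=> ax bx cx; apply: (eq_lfun_frame E a x) => // j; rewrite add_lfunE.
have Vo : open (U a `&` U b `&` U c) by apply: openI => //; apply: openI.
have sh : hol_section E (U a `&` U b `&` U c) (frame_section E (a := a) j).
  by apply: hol_section_frame => y [[]].
have omegaj d d' : U a `&` U b `&` U c `<=` U d `&` U d' ->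
    omega d d' x u (tnth (frame E a x) j) =
    nabla d' (frame_section E j) x u - nabla d (frame_section E j) x u.
  by move=> Vd; apply: (omegaE d d').2 Vo Vd sh x u (conj (conj ax bx) cx).
rewrite !omegaj; [|by move=> y [[? ?] ?]..].
by rewrite [RHS]addrC addrA subrK.
Qed.

(** The left-hand side is what the coefficient of omega a b in the chart at x
    unfolds to: the matrix, at a point near x, of omega a b on the constant
    vector field w. *)
Lemma near_omega a b f x : U a x -> U b x -> U f x ->
  \forall z \near pcoord x, forall w,
  endmx E f (cinv (chart_at x) z) (omega a b (cinv (chart_at x) z)
    (w *m 'J (cmap (chart_at (cinv (chart_at x) z)) \o cinv (chart_at x)) z)) =
  chart_connmx E (nabla b) f (chart_at x) w z -
  chart_connmx E (nabla a) f (chart_at x) w z.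
Proof.
move=> ax bx fx.
have Vo : open (U a `&` U b `&` U f) by apply: openI => //; apply: openI.
apply: filterS (cimage_nbhs _ _ _ Vo (pcoord_cimage _ x (conj (conj ax bx) fx))).
by move=> z /cinv_cimage[[az bz] fz] w; rewrite endmx_omega.
Qed.

Lemma endmx_omega_pcoord a b f x w : U a x -> U b x -> U f x ->
  endmx E f x (omega a b x w) =
  chart_connmx E (nabla b) f (chart_at x) w (pcoord x) -
  chart_connmx E (nabla a) f (chart_at x) w (pcoord x).
Proof.
move=> ax bx fx; rewrite endmx_omega //.
by apply/matrixP => i j; rewrite !mxE !coeff_pcoord.
Qed.

Section Derivatives.
Variables (x : X) (f : A).
Hypothesis fx : U f x.
Let Gm a w z := chart_connmx E (nabla a) f (chart_at x) w z.

Lemma connmx_flat a : U a x -> flat_at (pcoord x) (Gm a).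
Proof.
move=> ax; split=> [w|u w]; first exact: differentiable_connmx.
exact: flat_connmx.
Qed.

Let Om a b w z := Gm b w z - Gm a w z.

Lemma near_frame : \forall z \near pcoord x, U f (cinv (chart_at x) z).
Proof.
have := cimage_nbhs _ _ _ (U_open f) (pcoord_cimage _ x fx).
by apply: filterS => z /cinv_cimage.
Qed.

Lemma near_tr_square a b c w : U a x -> U b x -> U c x ->
  \forall z \near pcoord x,
    coeff (trform E (endmul E (omega a b) (omega b c))) (chart_at x) w z =
    alternation (fun w => \tr (Om a b (nrow 0 w) z *m Om b c (nrow 1 w) z)) w.
Proof.
move=> ax bx cx.
apply: filterS3 (near_omega a b f x ax bx fx) (near_omega b c f x bx cx fx) near_frame.
move=> z abz bcz fz; rewrite /coeff.
apply: etrans (trform_mul E f _ _ _ _ fz) _.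
apply: etrans (alternation_mulmx _ _ _ _ _ _) _.
by apply: eq_alternation => u; rewrite !row_mul abz bcz.
Qed.

Lemma near_tr_cube a b w : U a x -> U b x ->
  \forall z \near pcoord x,
    coeff (trform E (endmul E (endmul E (omega a b) (omega a b)) (omega a b)))
      (chart_at x) w z =
    alternation (fun w => \tr (Om a b (nrow 0 w) z *m Om a b (nrow 1 w) z *m
      Om a b (nrow 2 w) z)) w.
Proof.
move=> ax bx; apply: filterS2 (near_omega a b f x ax bx fx) near_frame.
move=> z abz fz; rewrite /coeff.
apply: etrans (trform_cube E f _ _ _ fz) _.
apply: etrans (alternation_mulmx _ _ _ _ _ _) _.
by apply: eq_alternation => u; rewrite !row_mul !abz.
Qed.

Lemma tr_cube_difference a b v : U a x -> U b x ->
  trform E (endmul E (endmul E (omega a b) (omega a b)) (omega a b)) x v =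
  alt_tr3 ((Om a b) ^~ (pcoord x)) ((Om a b) ^~ (pcoord x)) ((Om a b) ^~ (pcoord x)) v.
Proof.
move=> ax bx; apply: etrans (trform_cube E f _ _ _ fx) _.
by apply: eq_alternation => u; rewrite !endmx_omega_pcoord.
Qed.

End Derivatives.

(** The frame over U a serves for the three connections. *)
Lemma dR_tr_square a b c x v : U a x -> U b x -> U c x ->
  3%:R * dR (trform E (endmul E (omega a b) (omega b c))) x v =
  trform E (endmul E (endmul E (omega a c) (omega a c)) (omega a c)) x v -
  trform E (endmul E (endmul E (omega a b) (omega a b)) (omega a b)) x v -
  trform E (endmul E (endmul E (omega b c) (omega b c)) (omega b c)) x v.
Proof.
move=> ax bx cx; rewrite !(tr_cube_difference x a) //.
have [dG diffG dGE] := derivative_trace_square_flat (pcoord x) _ _ _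
  (connmx_flat x a ax a ax) (connmx_flat x a ax b bx) (connmx_flat x a ax c cx).
rewrite (dR_alternation _ _ _ _ _ (fun w => near_tr_square x a ax a b c w ax bx cx) diffG).
have cubeE := alt_tr3_cocycle (pcoord x) (chart_connmx E (nabla a) a (chart_at x))
  (chart_connmx E (nabla b) a (chart_at x)) (chart_connmx E (nabla c) a (chart_at x)) v.
rewrite dGE; exact: middle_summand cubeE.
Qed.

Lemma dR_tr_cube a b x v : U a x -> U b x ->
  dR (fun y w => 3%:R^-1 * trform E (endmul E (endmul E (omega a b) (omega a b))
    (omega a b)) y w) x v = 0.
Proof.
move=> ax bx.
have [dG diffG dGE] := derivative_trace_cube_flat (pcoord x) _ _ 3%:R^-1
  (connmx_flat x a ax a ax) (connmx_flat x a ax b bx).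
rewrite (dR_alternation _ _ _ _ _ _ diffG) // => w.
apply: filterS (near_tr_cube x a ax a b w ax bx) => z trE.
by rewrite alternationZ -trE.
Qed.

End Differences.

(** * Cech differentials and the total cocycle *)

Section Endomorphisms.
Context {R : realType} {X : complex_manifold R} {A : Type} {U : A -> set X}.
Variable E : hol_bundle U.
Local Notation C := (Cplx R).

Lemma endmulDl p q (eta eta1 eta2 : endform E p) (theta : endform E q) x v :
  (forall u, eta x u = eta1 x u + eta2 x u) ->
  endmul E eta theta x v = endmul E eta1 theta x v + endmul E eta2 theta x v.
Proof.
move=> etaD; rewrite /endmul /wedge -scalerDr -big_split; congr (_ *: _).
by apply: eq_bigr => s _; rewrite etaD comp_lfunDl scalerDr.
Qed.

Lemma endmulDr p q (eta : endform E p) (theta theta1 theta2 : endform E q) x v :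
  (forall u, theta x u = theta1 x u + theta2 x u) ->
  endmul E eta theta x v = endmul E eta theta1 x v + endmul E eta theta2 x v.
Proof.
move=> thetaD; rewrite /endmul /wedge -scalerDr -big_split; congr (_ *: _).
by apply: eq_bigr => s _; rewrite thetaD comp_lfunDr scalerDr.
Qed.

Lemma lftrace_sum (V : vectType C) (I : finType) (k : I -> C) (phi : I -> 'End(V)) :
  lftrace (\sum_i k i *: phi i) = \sum_i k i * lftrace (phi i).
Proof.
rewrite /lftrace; under [RHS]eq_bigr do rewrite mulr_sumr.
rewrite exchange_big; apply: eq_bigr => j _; rewrite sum_lfunE linear_sum.
by apply: eq_bigr => i _; rewrite scale_lfunE linearZ.
Qed.

Lemma lftrace0 (V : vectType C) : lftrace (0 : 'End(V)) = 0.
Proof. by rewrite /lftrace big1 // => i _; rewrite zero_lfunE linear0. Qed.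

Lemma dR_zero q (x : X) v : dR ((fun _ _ => 0) : @Defs.form R X q) x v = 0.
Proof.
rewrite /dR big1 // => i _.
rewrite (_ : coeff _ _ _ = cst 0) // diff_cst.
exact: mulr0.
Qed.

End Endomorphisms.

(** With s, t and r standing for omega_12 omega_23, omega_01 omega_23 and
    omega_01 omega_12, this is the Cech differential of omega_01 omega_12. *)
Lemma telescoping_sum {V : zmodType} (s t r : V) : s - (t + s) + (r + t) - r = 0.
Proof.
have -> : s - (t + s) = - t by rewrite opprD addrCA subrr addr0.
by rewrite (addrC r) addKr subrr.
Qed.

(** Here d stands for d tr (omega_01 omega_12), and s, t and r for the traces of
    the cubes of omega_02, omega_01 and omega_12. *)
Lemma third_cancel {K : numFieldType} (d s t r : K) : 3%:R * d = s - t - r ->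
  3%:R^-1 * r - 3%:R^-1 * s + 3%:R^-1 * t + (-1) ^+ 2 * d = 0.
Proof.
move=> dE; have -> : d = 3%:R^-1 * (s - t - r) by rewrite -dE mulKf ?pnatr_eq0.
by rewrite sqrrN expr1n mul1r; ring.
Qed.

Section AlternatingSums.
Context {K : pzRingType} {V : lmodType K}.

Lemma alternating_sum3 (F : 'I_3 -> V) :
  \sum_(k < 3) (-1) ^+ k *: F k =
  F ord0 - F (lift ord0 ord0) + F (lift ord0 (lift ord0 ord0)).
Proof.
rewrite !big_ord_recl big_ord0 addr0 /bump /=.
by rewrite expr0 expr1 sqrrN expr1n !scale1r scaleN1r addrA.
Qed.

Lemma alternating_sum4 (F : 'I_4 -> V) :
  \sum_(k < 4) (-1) ^+ k *: F k =
  F ord0 - F (lift ord0 ord0) + F (lift ord0 (lift ord0 ord0)) -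
  F (lift ord0 (lift ord0 (lift ord0 ord0))).
Proof.
rewrite !big_ord_recl big_ord0 addr0 /bump /=.
rewrite expr0 expr1 sqrrN expr1n (exprS _ 2) sqrrN expr1n mulr1.
by rewrite !scale1r !scaleN1r !addrA.
Qed.

End AlternatingSums.

Lemma comp_lift_inord (n : nat) (B : Type) (a : 'I_n.+2 -> B) (k : 'I_n.+2) (j : nat) :
  (j <= n)%N -> (a \o lift k) (inord j) = a (inord (bump k j)).
Proof.
move=> jn; rewrite /=; congr a; apply: val_inj; rewrite /= !inordK //.
by rewrite /bump ltnS; case: (k <= j)%N; rewrite ?add1n ?add0n ?ltnS ?leqW.
Qed.

Theorem mainTheorem1 (R : realType) (X : complex_manifold R)
    (A : Type) (U : A -> set X) (E : hol_bundle U)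
    (nabla : A -> section_of E -> eform E 1)
    (omega : A -> A -> endform E 1)
    (X_paracompact : paracompact X)
    (U_cover : open_cover U)
    (U_locally_finite : locally_finite U)
    (U_stein : forall (p : nat) (a : 'I_p.+1 -> A), stein (inter U a))
    (nabla_conn : forall a, hol_connection E (U a) (nabla a))
    (nabla_flat : forall a, flat_connection E a (nabla a))
    (omegaE : forall a b,
       conn_difference E (U a `&` U b) (nabla a) (nabla b) (omega a b)) :
  [/\ end_cocycle E (atiyah2 E omega),
      atiyah2_tot E omega 2%N 2%N = tr_cochain E (atiyah2 E omega),
      in_Tot U 4 (atiyah2_tot E omega)
    & tot_closed U (atiyah2_tot E omega)].
Proof.
have U_open : forall a, open (U a) by case: U_cover.
have interO p (a : 'I_p.+1 -> A) : open (inter U a) by case: (U_stein p a).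
have omega_hol p (a : 'I_p.+1 -> A) i j :
    hol_endform E (inter U a) (omega (a i) (a j)).
  by apply: hol_endform_sub (omegaE (a i) (a j)).1 => x ax; split; apply: ax.
have at2_hol (a : 'I_3 -> A) : hol_endform E (inter U a) (atiyah2 E omega a).
  exact: (hol_endform_mul E U_open 1 1 _ _ _ (interO _ a)).
have cube_hol (a : 'I_2 -> A) : hol_endform E (inter U a) (omega_cube E omega a).
  have square_hol := hol_endform_mul E U_open 1 1 _ _ _ (interO _ a)
    (omega_hol _ a (inord 0) (inord 1)) (omega_hol _ a (inord 0) (inord 1)).
  exact: (hol_endform_mul E U_open 2 1 _ _ _ (interO _ a) square_hol).
have at2_cocycle : cochain_eq0 U (cech_diff (atiyah2 E omega)).
  move=> a x v ax; rewrite /cech_diff alternating_sum4 /atiyah2.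
  rewrite !comp_lift_inord // /bump /= ?addn0 ?add1n ?add0n.
  have omegaD i j k u := omega_cocycle E U_open nabla omega omegaE
    (a i) (a j) (a k) x u (ax i) (ax j) (ax k).
  rewrite (endmulDl E _ _ _ _ _ _ _ _ (omegaD (inord 0) (inord 1) (inord 2))).
  rewrite (endmulDr E _ _ _ _ _ _ _ _ (omegaD (inord 1) (inord 2) (inord 3))).
  exact: telescoping_sum.
have zero_hol p q : hol_cochain U ((fun _ _ _ => 0) : @omega_cochain R X A p q).
  by move=> a; apply: hol_form0.
have cech0 p q a x v : cech_diff ((fun _ _ _ => 0) : @omega_cochain R X A p q) a x v = 0.
  by rewrite /cech_diff big1 // => k _; rewrite scaler0.
split=> //.
(* The components are holomorphic, and zero outside of the degrees (1, 3) and (2, 2). *)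
- move=> p q; move: p q => [|[|[|p]]] [|[|[|[|q]]]]; split=> //; try exact: zero_hol.
  + move=> a; apply: hol_formZ.
    exact: (hol_trform E 3 _ (a ord0) _ (interO _ a) (fun x ax => ax _) (cube_hol a)).
  + move=> a.
    exact: (hol_trform E 2 _ (a ord0) _ (interO _ a) (fun x ax => ax _) (at2_hol a)).
(* Only the bidegrees (1, 4), (2, 3) and (3, 2) are not trivially zero. *)
move=> p q; move: p q => [|[|[|[|p]]]] [|[|[|[|[|q]]]]] a x v ax;
  rewrite /tot_diff /= ?cech0 ?dR_zero ?mulr0 ?add0r ?addr0 //.
(* bidegree (1, 4) *)
- have dcube := dR_tr_cube E U_open nabla omega nabla_conn nabla_flat omegaE
    _ _ x v (ax (inord 0)) (ax (inord 1)).
  exact: etrans (congr1 _ dcube) (mulr0 _).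
(* bidegree (2, 3) *)
- rewrite /cech_diff alternating_sum3 /tr_cochain /omega_cube.
  rewrite !comp_lift_inord // /bump /= ?addn0 ?add1n ?add0n.
  have dsquare := dR_tr_square E U_open nabla omega nabla_conn nabla_flat omegaE
    _ _ _ x v (ax (inord 0)) (ax (inord 1)) (ax (inord 2)).
  exact: third_cancel dsquare.
(* bidegree (3, 2): the trace commutes with the Cech differential *)
- have trE : cech_diff (tr_cochain E (atiyah2 E omega)) a x v =
      lftrace (cech_diff (atiyah2 E omega) a x v).
    by rewrite /cech_diff lftrace_sum.
  by rewrite trE at2_cocycle // lftrace0.
Qed.
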